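(* Let $\mathcal{M}=\{\mathcal{M}_t\}_{t\in[0,1]}$ be the stable-like process associated with a function $\beta$ (see context), and let $\mu$ be its occupation measure. With probability $1$, for every $x\in\operatorname{Supp}(\mu)$, $$\underline{\dim}(\mu,x)=\beta(x)\quad\text{and}\quad \overline{\dim}(\mu,x)\in[\beta(x),2\beta(x)].$$
   Context: Fix $\varepsilon_0>0$ and let $\beta:\mathbb{R}\to[\varepsilon_0,1-\varepsilon_0]$ be a nowhere constant (not constant on any nontrivial interval), non-decreasing, Lipschitz continuous map. Let $N(dt,dz)$ be a Poisson random measure on $[0,\infty)\times(0,\infty)$ with intensity $dt\otimes dz/z^2$ and let $(\mathcal F_t)$ be its natural filtration. The stable-like process $\mathcal{M}$ associated with $\beta$ is the unique càdlàg $(\mathcal F_t)$-adapted solution of $\mathcal{M}_t=\int_0^t\int_0^1 z^{1/\beta(\mathcal{M}_{u-})}\,N(du,dz)$, $t\in[0,1]$; it is an increasing, pure jump, strong Markov process with generator $f\mapsto \int_0^1 (f(x+u)-f(x))\beta(x)u^{-1-\beta(x)}\,du$. Its occupation measure is $\mu(A)=\int_0^1 \mathbf 1_A(\mathcal{M}_t)\,dt$ for Borel $A\subset\mathbb{R}$. $\operatorname{Supp}(\mu)=\{x\in\mathbb{R}:\forall r>0,\ \mu(B(x,r))>0\}$. For $x\in\operatorname{Supp}(\mu)$, $\overline{\dim}(\mu,x)=\limsup_{r\downarrow0}\frac{\log\mu(B(x,r))}{\log r}$ and $\underline{\dim}(\mu,x)=\liminf_{r\downarrow0}\frac{\log\mu(B(x,r))}{\log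 r}$. *)

(* Defs.v *)
From HB Require Import structures.
From mathcomp Require Export all_boot all_order all_algebra.
From mathcomp Require Export all_classical all_reals all_analysis measurable_realfun.

Set Implicit Arguments.
Unset Strict Implicit.
Unset Printing Implicit Defensive.

Import Order.TTheory GRing.Theory Num.Theory.
Import numFieldNormedType.Exports.

Local Open Scope classical_set_scope.
Local Open Scope ring_scope.

Definition nowhere_constant (R : realType) (f : R -> R) : Prop :=
  forall a b c : R, a < b -> ~ (forall x, x \in `[a, b] -> f x = c).

Section PoissonRandomMeasure.
Context (R : realType) (d : measure_display) (Omega : measurableType d).

(* The measure dt (x) dz/z^2 on [0, oo) x (0, oo), as a measure on R x R
   carried by that quadrant. *)
Definition jump_intensity (A : set (R * R)) : \bar R :=
  (\int[lebesgue_measure \x lebesgue_measure]_(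
      p in A `&` (`[0%R, +oo[ `*` `]0%R, +oo[)) ((p.2 ^+ 2)^-1)%:E)%E.

(* The measurability in [w] of [N w A] is part of the kernel structure.  The
   Poisson law is spelled out because [poisson_pmf 0 k] is 1 for every [k],
   whereas sets of intensity 0 must have count 0 almost surely. *)
Definition poisson_random_measure (P : probability Omega R)
    (nu : set (R * R) -> \bar R) (N : R.-ker Omega ~> (R * R)%type) : Prop :=
  [/\ forall w (A : set (R * R)), measurable A ->
        N w A = +oo%E \/ exists n : nat, N w A = (n%:R)%:E,
      forall A : set (R * R), measurable A -> (nu A < +oo)%E ->
        forall k : nat,
          P [set w | N w A = (k%:R)%:E] =
          (fine (nu A) ^+ k / k`!%:R * expR (- fine (nu A)))%:E
    & forall (n : nat) (A : 'I_n -> set (R * R)) (C : 'I_n -> set (\bar R)),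
        (forall i, measurable (A i)) -> trivIset setT A ->
        (forall i, measurable (C i)) ->
        P (\bigcap_(i in [set: 'I_n]) [set w | C i (N w (A i))]) =
        (\prod_(i < n) P [set w | C i (N w (A i))])%E].

Definition natural_filtration (N : R.-ker Omega ~> (R * R)%type) (t : R) :
    set (set Omega) :=
  <<s [set E | exists A : set (R * R),
         [/\ measurable A, A `<=` `[0, t] `*` `]0, +oo[
           & preimage_set_system setT (N^~ A) measurable E]] >>.

Definition adapted (N : R.-ker Omega ~> (R * R)%type) (M : R -> Omega -> R) : Prop :=
  forall t, t \in `[0, 1] -> forall B : set R, measurable B ->
    natural_filtration N t (M t @^-1` B).

End PoissonRandomMeasure.

Section Paths.
Context (R : realType).
Implicit Types (X : R -> R) (beta : R -> R).

Definition cadlag X : Prop :=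
  (forall t, t \in `[0, 1[ -> X s @[s --> t^'+] --> X t) /\
  (forall t, t \in `]0, 1] -> cvg (X s @[s --> t^'-])).

Definition left_limit X (u : R) : R := lim (X s @[s --> u^'-]).

(* [n] is a realization of the Poisson random measure.  The integrand is
   nonnegative, so the integral against [n] is an ordinary Lebesgue integral
   with values in [0, +oo]; the equation includes its finiteness. *)
Definition solves_jump_equation beta (n : {measure set (R * R) -> \bar R}) X :
    Prop :=
  forall t, t \in `[0, 1] ->
    (X t)%:E =
    (\int[n]_(p in `]0%R, t] `*` `]0%R, 1%R])
       (p.2 `^ (beta (left_limit X p.1))^-1)%:E)%E.

Definition occupation_measure X (A : set R) : \bar R :=
  (\int[lebesgue_measure]_(t in `[0%R, 1%R]) (\1_A (X t))%:E)%E.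

Definition msupport (m : set R -> \bar R) : set R :=
  [set x | forall r, 0 < r -> (0 < m (ball x r))%E].

Definition log_mass_ratio (m : set R -> \bar R) (x r : R) : \bar R :=
  (ln (fine (m (ball x r))) / ln r)%:E.

Definition upper_local_dim (m : set R -> \bar R) (x : R) : \bar R :=
  limf_esup (log_mass_ratio m x) 0^'+.

Definition lower_local_dim (m : set R -> \bar R) (x : R) : \bar R :=
  limf_einf (log_mass_ratio m x) 0^'+.

End Paths.

Section StableLike.
Context (R : realType) (d : measure_display) (Omega : measurableType d).

Definition stable_like_process (P : probability Omega R)
    (N : R.-ker Omega ~> (R * R)%type) (beta : R -> R) (M : R -> Omega -> R) : Prop :=
  [/\ adapted N M,
      {ae P, forall w, cadlag (M^~ w)}
    & {ae P, forall w, solves_jump_equation beta (N w) (M^~ w)}].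

End StableLike.

(* Main.v *)
(* Since z^(1/b) is nondecreasing in b for z in (0,1], a path of the process is
   controlled on short intervals by the marks of the Poisson measure alone: by
   continuity of beta, near x a mark z produces a jump of size about
   z^(1/beta(x)).  The path being nondecreasing, the mass of B(x,r) is the length
   of the time interval that the path spends in it, and every x in the support is
   X_t or X_{t-} for some t.  Four uniform almost sure facts give the theorem.

   - Every interval of length h contains a mark at least h^(1+eps); hence
     mu(B(x,r)) <= C r^(beta(x)-eps).
   - Marks below h^(1-eps) (or any larger threshold) are so evenly spread that
     over an interval of length h they contribute no more than a constant times
     what a single mark at the threshold would.
   - No interval of length h contains two marks above h^(1/2-eps).  So on at
     least one side of t the increment over time h is at most h^(1/(2 beta)-eps),
     and mu(B(x,r)) >= r^(2 beta(x)+eps).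
   - No time t has, for all small h, a mark above h^(1-eps) at distance less than
     h.  Such a t would be approached by a chain of such marks, each within the
     scale of the previous one; each link costs a factor h^eps, so chains of more
     than 1/eps links do not occur at small scales.  Hence
     mu(B(x,r)) >= r^(beta(x)+eps) along a sequence of radii. *)

Require Import Defs.
From mathcomp Require Import ring lra zify.

Set Implicit Arguments.
Unset Strict Implicit.
Unset Printing Implicit Defensive.

Import Order.TTheory GRing.Theory Num.Theory.
Import numFieldNormedType.Exports.

Local Open Scope classical_set_scope.
Local Open Scope ring_scope.

(** * Elementary bounds for the exponential *)

Section Exponential.
Variable R : realType.
Implicit Types x : R.

(** Since [(m + i)!] is at least [m! * i!], each term of the tail is at most [x ^+ m / m!] times a
    term of the full series. After multiplication by [expR (- x)] this is the tail bound for a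
    Poisson variable. *)
Lemma expR_taylor_tail (m : nat) x : 0 <= x ->
  expR x - \sum_(k < m) x ^+ k / k`!%:R <= x ^+ m / m`!%:R * expR x.
Proof.
move=> x0.
have e0 k : 0 <= exp_coeff x k :> R by exact: exp_coeff_ge0.
have partial n : series (exp_coeff x) n <= expR x.
  apply: nondecreasing_cvgn_le; last exact: is_cvg_series_exp_coeff.
  by apply/nondecreasing_seqP => k; rewrite /series/= big_nat_recr//= lerDl.
rewrite lerBlDl /expR; apply: limr_le; first exact: is_cvg_series_exp_coeff.
near=> n.
have mn : (m <= n)%N by near: n; exists m.
rewrite -(subnKC mn) /series/= (@big_cat_nat _ _ _ m)//= ?leq_addr//.
rewrite big_mkord lerD//.
rewrite -{1}[m]add0n big_addn addKn.
apply: (@le_trans _ _ (\sum_(0 <= i < n - m) x ^+ m / m`!%:R * exp_coeff x i)).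
  apply: ler_sum_nat => i _; rewrite /exp_coeff/= addnC exprD mulrACA -invfM.
  rewrite ler_wpM2l//; first by rewrite mulr_ge0 ?exprn_ge0.
  rewrite lef_pV2 ?posrE ?mulr_gt0 ?ltr0n ?fact_gt0// -natrM ler_nat.
  by rewrite -(bin_fact (leq_addr i m)) addKn leq_pmull// bin_gt0 leq_addr.
rewrite -mulr_sumr ler_wpM2l//; last exact: partial.
by rewrite divr_ge0// exprn_ge0.
Unshelve. all: end_near. Qed.

(** The left side is a single term of the Taylor series of [expR m]. *)
Lemma fact_ge_expR (m : nat) : m%:R ^+ m / m`!%:R <= expR 1 ^+ m :> R.
Proof.
case: m => [|m]; first by rewrite fact0 !expr0 divr1.
rewrite -expRM_natr mul1r.
apply: le_trans (expR_ge1Dxn m _) => //; by rewrite lerDr.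
Qed.

(** Stirling in the form [x ^+ m / m! <= (e * x / m) ^+ m]: a Poisson count of mean [x] exceeds a
    large multiple of [x] with exponentially small probability. *)
Lemma pow_div_fact_le (m : nat) x y : 0 <= x -> 0 <= y ->
  expR 1 * x <= y * m%:R -> x ^+ m / m`!%:R <= y ^+ m.
Proof.
case: m => [|m] x0 y0 h; first by rewrite fact0 !expr0 divr1.
have h' : (expR 1 * x) ^+ m.+1 <= (y * m.+1%:R) ^+ m.+1.
  by rewrite ler_pXn2r// nnegrE mulr_ge0 ?expR_ge0.
have f := fact_ge_expR m.+1.
rewrite !exprMn in h'.
have m0 : 0 < m.+1%:R ^+ m.+1 :> R by rewrite exprn_gt0.
rewrite -(ler_pM2r m0); apply: le_trans h'.
by rewrite mulrAC -mulrA mulrC ler_wpM2r// exprn_ge0.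
Qed.

(** From [expR (- 1/2) >= 1/2] comes [expR (1/2) <= 2], which is then squared. *)
Lemma expR_le4 : expR 1 <= 4 :> R.
Proof.
have := expR_ge1Dx (- 2^-1 : R); rewrite expRN => h.
have e0 := expR_gt0 (2^-1 : R).
have h2 : expR 2^-1 <= 2 :> R.
  rewrite -[leLHS]invrK -[leRHS]invrK lef_pV2 ?posrE ?invr_gt0//.
  by apply: le_trans h; lra.
have -> : (1 : R) = 2^-1 + 2^-1 by lra.
by rewrite expRD; nra.
Qed.

Lemma expRN_le_pow (m : nat) x : 0 < x -> expR (- x) <= m`!%:R / x ^+ m.
Proof.
move=> x0; rewrite expRN -[leRHS]invrK lef_pV2 ?posrE ?expR_gt0//; last first.
  by rewrite invr_gt0 divr_gt0 ?exprn_gt0// ltr0n fact_gt0.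
rewrite invf_div; case: m => [|m].
  rewrite fact0 expr0 divr1; apply: le_trans (expR_ge1Dx x); lra.
by apply: le_trans (expR_ge1Dxn m (ltW x0)); rewrite lerDr.
Qed.

End Exponential.

(** * Union bounds and the Borel-Cantelli lemma *)

Section UnionBounds.
Local Open Scope ereal_scope.
Context d (T : measurableType d) (R : realType).
Variable mu : {measure set T -> \bar R}.

Lemma measure_bigcup_geometric (F : (set T)^nat) (c : R) :
  (forall j, measurable (F j)) ->
  (forall j, mu (F j) <= (c * 2^-1 ^+ j)%:E) ->
  mu (\bigcup_j F j) <= (2 * c)%:E.
Proof.
move=> mF hF.
apply: (@le_trans _ _ (\sum_(j <oo) mu (F j))).
  by apply: measure_sigma_subadditive => //; exact: bigcup_measurable.
have c0 : (0 <= c)%R.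
  by have := le_trans (measure_ge0 mu (F 0%N)) (hF 0%N); rewrite lee_fin expr0 mulr1.
apply: (@le_trans _ _ (\sum_(j <oo) (geometric c 2^-1 j)%:E)).
  by apply: lee_nneseries => // j _; exact: hF.
have : (series (geometric c (2^-1)) @ \oo --> c * (1 - 2^-1)^-1)%R.
  by apply: cvg_geometric_series; rewrite ger0_norm; lra.
move=> h; rewrite le_eqVlt; apply/orP; left; apply/eqP; apply/cvg_lim => //.
under eq_fun do rewrite sumEFin.
apply: cvg_EFin; first by apply: nearW => n; rewrite fin_numE.
rewrite /comp/=; suff -> : (2 * c = c * (1 - 2^-1)^-1)%R by exact: h.
by field.
Qed.

Lemma measure_exists_lt (F : (set T)^nat) (n : nat) (b : R) :
  (forall j, measurable (F j)) ->
  (forall j, (j < n)%N -> mu (F j) <= b%:E) ->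
  mu [set w | exists2 j, (j < n)%N & F j w] <= (n%:R * b)%:E.
Proof.
move=> mF hF.
have -> : [set w | exists2 j, (j < n)%N & F j w] = \big[setU/set0]_(j < n) F j.
  by rewrite -bigcup_mkord.
elim: n hF => [|n ih] hF; first by rewrite big_ord0 measure0 mul0r.
rewrite big_ord_recr/=; apply: le_trans.
  by apply: measureU2 => //; exact: bigsetU_measurable.
rewrite -addn1 natrD mulrDl mul1r EFinD leeD ?hF// ih// => j jn.
by apply: hF; exact: ltnW.
Qed.

(** Borel-Cantelli with a geometric rate: the unions of the tails of [F] have measure tending to 0,
    so their intersection is null. *)
Lemma ae_eventually_not (F : (set T)^nat) (c : R) :
  (forall k, measurable (F k)) ->
  (forall k, (0 < k)%N -> mu (F k) <= (c * 2^-1 ^+ k)%:E) ->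
  {ae mu, forall w, exists K, forall k, (K <= k)%N -> ~ F k w}.
Proof.
move=> mF hF.
(* The tails start at [n + 1] because the bound is assumed for positive indices only. *)
pose G n := \bigcup_j F (n + 1 + j)%N.
have mG n : measurable (G n) by exact: bigcup_measurable.
have hG n : mu (G n) <= (2 * (c * 2^-1 ^+ (n + 1)))%:E.
  apply: measure_bigcup_geometric => // j.
  by rewrite -mulrA -exprD hF// addn1.
exists (\bigcap_n G n); split.
- exact: bigcap_measurable.
- apply/eqP; rewrite eq_le measure_ge0 andbT.
  apply/lee_addgt0Pr => e e0; rewrite add0e.
  have c0 : (0 <= c)%R.
    have := le_trans (measure_ge0 mu (G 0%N)) (hG 0%N); rewrite lee_fin.
    by rewrite pmulr_rge0// pmulr_lge0// exprn_gt0.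
  have [n hn] : exists n, (2 * (c * 2^-1 ^+ (n + 1)) <= e)%R.
    have : ((fun n => geometric (2 * c) 2^-1 n) @ \oo --> (0 : R))%R.
      by apply: cvg_geometric; rewrite ger0_norm; lra.
    move=> /cvgrPdist_le /(_ e e0) [n _ /(_ (n + 1)%N)] /= h.
    exists n; rewrite mulrA; apply: le_trans (h _); last by rewrite /= leq_addr.
    by rewrite sub0r normrN ler_norm.
  apply: (@le_trans _ _ (mu (G n))); last first.
    by apply: (le_trans (hG n)); rewrite lee_fin.
  apply: le_measure; rewrite ?inE//; first exact: bigcap_measurable.
  exact: bigcap_inf.
- move=> w /= nw n _; apply: contrapT => nG; apply: nw; exists (n + 1)%N => k nk Fk.
  by apply: nG; exists (k - (n + 1))%N => //; rewrite subnKC.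
Qed.

End UnionBounds.

Section NonnegIntegral.
Local Open Scope ereal_scope.
Context d (T : measurableType d) (R : realType).
Variable mu : {measure set T -> \bar R}.

(* The integral of a nonnegative function is the supremum of the integrals of
   the simple functions below it, measurable or not. *)
Lemma ge0_le_integral_subset (A B : set T) (f g : T -> \bar R) :
  (forall x, A x -> 0 <= f x) -> (forall x, B x -> 0 <= g x) ->
  (forall x, A x -> B x /\ f x <= g x) ->
  \int[mu]_(x in A) f x <= \int[mu]_(x in B) g x.
Proof.
move=> f0 g0 fg; rewrite !ge0_integralE//.
apply: ge_ereal_sup => _ [h/= hf] <-; apply: ereal_sup_ubound; exists h => // x.
apply: le_trans (hf x) _; rewrite /patch; case: ifPn => [|_].
  by rewrite inE => /fg[Bx fgx]; rewrite mem_set.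
by case: ifPn => //; rewrite inE => /g0.
Qed.

End NonnegIntegral.

(** * The intensity of rectangles *)

Section JumpIntensity.
Variable R : realType.
Local Notation nu := (@jump_intensity R).
Local Notation leb := (@lebesgue_measure R).

Lemma measurable_setX (A B : set R) : measurable A -> measurable B ->
  measurable (A `*` B).
Proof. exact: measurableX. Qed.

Lemma jump_intensityS (A B : set (R * R)) : A `<=` B -> (nu A <= nu B)%E.
Proof.
move=> AB; apply: ge0_le_integral_subset.
- by move=> p _; rewrite lee_fin invr_ge0 sqr_ge0.
- by move=> p _; rewrite lee_fin invr_ge0 sqr_ge0.
- by move=> p [/AB ? ?].
Qed.

Lemma measurable_inv_sqr (A : set (R * R)) : measurable A ->
  measurable_fun (A `&` (`[0, +oo[ `*` `]0, +oo[))
    (fun p : R * R => ((p.2 ^+ 2)^-1)%:E).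
Proof.
move=> mA; apply/measurable_EFinP.
apply: (@eq_measurable_fun _ _ _ _ _ (fun p : R * R => powR p.2 (- 2))).
  move=> p; rewrite inE => -[_ [_]] /=; rewrite in_itv/= andbT => p0.
  by rewrite powRN powR_mulrn// ltW.
apply: measurable_funTS.
apply: (@measurableT_comp _ _ _ _ _ _ (@powR R ^~ (- 2))) => //.
Qed.

Lemma jump_intensityU (A B : set (R * R)) : measurable A -> measurable B ->
  (nu (A `|` B) <= nu A + nu B)%E.
Proof.
move=> mA mB.
have mQ : measurable (`[0%R, +oo[ `*` `]0%R, +oo[ : set (R * R)).
  exact: measurable_setX.
have mAQ : measurable (A `&` (`[0%R, +oo[ `*` `]0%R, +oo[)).
  exact: measurableI.
have mBQ : measurable ((B `\` A) `&` (`[0%R, +oo[ `*` `]0%R, +oo[)).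
  by apply: measurableI => //; exact: measurableD.
have -> : A `|` B = A `|` (B `\` A) by rewrite setDE setUIr setUv setIT.
have mf := measurable_inv_sqr (measurableU _ _ mA (measurableD mB mA)).
rewrite setIUl in mf.
have -> : nu (A `|` (B `\` A)) = (nu A + nu (B `\` A))%E.
  rewrite /jump_intensity setIUl; apply: ge0_integral_setU => //.
    by move=> p _; rewrite lee_fin invr_ge0 sqr_ge0.
  by apply/disj_setPS => p [[? _] [[_ ?] _]].
by apply: leeD => //; apply: jump_intensityS => p [].
Qed.

Lemma integral_cst_rect (i j : interval R) (r : R) :
  (\int[leb \x leb]_(p in [set` i] `*` [set` j]) r%:E =
   r%:E * (leb [set` i] * leb [set` j]))%E.
Proof.
transitivity (r%:E * (leb \x leb)%E ([set` i] `*` [set` j]))%E.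
  by apply: integral_cst; exact: measurable_setX.
by congr (_ * _)%E; exact: product_measure1E.
Qed.

(** The density is at most [c ^- 2] on a strip of marks of width [c]. *)
Lemma jump_intensity_block_le (a b c : R) : a <= b -> 0 < c ->
  (nu (`[a, b] `*` `[c, (2 * c)%R]) <= ((b - a) / c)%:E)%E.
Proof.
move=> ab c0.
apply: (@le_trans _ _ (\int[leb \x leb]_(p in `[a, b] `*` `[c, (2 * c)%R])
   (c ^+ 2)^-1%:E)%E).
  apply: ge0_le_integral_subset.
  - by move=> p _; rewrite lee_fin invr_ge0 sqr_ge0.
  - by move=> p _; rewrite lee_fin invr_ge0 sqr_ge0.
  move=> p [[p1 p2] _]; split=> //; move: p2; rewrite /= in_itv/= => /andP[p2 _].
  rewrite lee_fin lef_pV2 ?posrE ?exprn_gt0//; last exact: lt_le_trans p2.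
  by rewrite ler_pXn2r// nnegrE ltW//; exact: lt_le_trans p2.
rewrite integral_cst_rect !lebesgue_measure_itv/= !lte_fin.
have -> : c < 2 * c by lra.
case: ltP => [ab'|ba].
  rewrite -!EFinD -!EFinM lee_fin.
  have -> : (c ^+ 2)^-1 * ((b - a) * (2 * c - c)) = (b - a) / c by field; rewrite gt_eqF.
  by [].
by rewrite mul0e mule0 lee_fin divr_ge0 ?subr_ge0// ltW.
Qed.

Lemma jump_intensity_block_ge (a b c : R) : 0 <= a -> a <= b -> 0 < c ->
  (((b - a) / (4 * c))%:E <= nu (`]a, b] `*` `[c, (2 * c)%R]))%E.
Proof.
move=> a0 ab c0.
have : (\int[leb \x leb]_(p in `]a, b] `*` `[c, (2 * c)%R])
   ((2 * c) ^+ 2)^-1%:E <= nu (`]a, b] `*` `[c, (2 * c)%R]))%E.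
  apply: ge0_le_integral_subset.
  - by move=> p _; rewrite lee_fin invr_ge0 sqr_ge0.
  - by move=> p _; rewrite lee_fin invr_ge0 sqr_ge0.
  move=> [p1 p2] [/=]; rewrite !in_itv/= => /andP[ap pb] /andP[cp pc]; split.
    have p10 : 0 <= p1 by apply: ltW; exact: le_lt_trans ap.
    have p20 : 0 < p2 by exact: lt_le_trans cp.
    by split; split; rewrite /= ?in_itv/= ?ap ?pb ?cp ?pc ?p10 ?p20.
  have p0 : 0 < p2 by exact: lt_le_trans cp.
  rewrite lee_fin lef_pV2 ?posrE ?exprn_gt0 ?mulr_gt0//.
  by rewrite ler_pXn2r// nnegrE ?mulr_ge0// ltW.
rewrite integral_cst_rect !lebesgue_measure_itv/= !lte_fin.
have -> : c < 2 * c by lra.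
case: ltP => [ab'|ba].
  rewrite -!EFinD -!EFinM; apply: le_trans; rewrite lee_fin.
  have -> : ((2 * c) ^+ 2)^-1 * ((b - a) * (2 * c - c)) = (b - a) / (4 * c).
    by field; rewrite gt_eqF.
  by [].
have -> : a = b by lra.
by rewrite subrr mul0r mul0e mule0.
Qed.

(** Marks are peeled off in dyadic layers: the layer from [c / 2] to [c] costs as much as the bound
    already reached for the marks above [c], so the bound doubles at each halving. *)
Lemma jump_intensity_large_le (a b : R) (j : nat) : a <= b ->
  (nu (`[a, b] `*` `[(2^-1 ^+ j)%R, 1%R]) <= (2 * (b - a) / 2^-1 ^+ j)%:E)%E.
Proof.
move=> ab; elim: j => [|j ih].
  rewrite expr0; apply: (@le_trans _ _ (nu (`[a, b] `*` `[1%R, (2 * 1)%R]))).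
    apply: jump_intensityS => p [p1 p2]; split=> //.
    by move: p2; rewrite /= !in_itv/= => /andP[-> h]; apply: le_trans h _; lra.
  apply: le_trans (jump_intensity_block_le ab ltr01) _; rewrite lee_fin; lra.
set c := 2^-1 ^+ j in ih *; have -> : 2^-1 ^+ j.+1 = c / 2 by rewrite exprSr.
have c0 : 0 < c by exact: exprn_gt0.
apply: (@le_trans _ _ (nu ((`[a, b] `*` `[(c / 2)%R, (2 * (c / 2))%R]) `|`
    (`[a, b] `*` `[c, 1%R])))).
  apply: jump_intensityS => p [p1 p2].
  move: p2; rewrite /= in_itv/= => /andP[cp p21].
  case: (leP p.2 c) => [pc|pc]; [left|right]; split => //=; rewrite in_itv/=.
    by rewrite cp/= (le_trans pc)//; lra.
  by rewrite p21 (ltW pc).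
apply: le_trans (jump_intensityU _ _) _; [exact: measurable_setX..|].
apply: le_trans (leeD (jump_intensity_block_le ab _) ih) _; first by rewrite divr_gt0.
rewrite -EFinD lee_fin.
rewrite le_eqVlt; apply/orP; left; apply/eqP; field; rewrite gt_eqF//.
Qed.

End JumpIntensity.

(** * Tails and independence of Poisson counts *)

Section PoissonCounts.
Local Open Scope ereal_scope.
Context (R : realType) d (Omega : measurableType d) (P : probability Omega R).
Variable N : R.-ker Omega ~> (R * R)%type.
Hypothesis N_poisson : poisson_random_measure P (@jump_intensity R) N.
Local Notation nu := (@jump_intensity R).

Definition count_ge (m : nat) (A : set (R * R)) : set Omega :=
  [set w | m%:R%:E <= N w A].

Lemma count_ltP (m : nat) A w : measurable A ->
  ~ count_ge m.+1 A w -> N w A <= m%:R%:E.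
Proof.
case: N_poisson => Nint _ _ mA /negP; rewrite -ltNge.
case: (Nint w A mA) => [->|[n ->]]; first by rewrite ltNge leey.
by rewrite lte_fin lee_fin ltr_nat ler_nat.
Qed.

Lemma measurable_count_ge m A : measurable A -> measurable (count_ge m A).
Proof.
move=> mA; rewrite -[count_ge _ _]setTI.
have -> : count_ge m A = (N ^~ A) @^-1` `[m%:R%:E, +oo[%classic `|` (N ^~ A) @^-1` [set +oo].
  apply/seteqP; split => w /=; rewrite /count_ge/= in_itv/= andbT.
    by case: (leP (N w A) m%:R%:E) => //; left.
  by move=> [//|->]; rewrite leey.
rewrite setIUr; apply: measurableU.
  by apply: (measurable_kernel N A mA) => //; exact: emeasurable_itv.
by apply: (measurable_kernel N A mA) => //; exact: emeasurable_set1.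
Qed.

Lemma measurable_count_eq (m : nat) A : measurable A ->
  measurable [set w | N w A = m%:R%:E].
Proof.
move=> mA; rewrite -[X in measurable X]setTI.
exact: (measurable_kernel N A mA measurableT _ (emeasurable_set1 _)).
Qed.

(** The complement is the disjoint union of the events that the count is [k], for [k < m]; its
    probability is [expR (- l)] times a Taylor polynomial of [expR l], where [l] is the intensity of
    [A]. *)
Lemma count_ge_le (m : nat) A (x : R) : measurable A -> nu A <= x%:E ->
  P (count_ge m A) <= (x ^+ m / m`!%:R)%:E.
Proof.
case: N_poisson => Nint Npmf _ mA nuA.
have nu0 : 0 <= nu A by apply: integral_ge0 => p _; rewrite lee_fin invr_ge0 sqr_ge0.
have nuoo : nu A < +oo by exact: le_lt_trans (ltry x).
have [l nul] : exists l, nu A = l%:E by exists (fine (nu A)); rewrite fineK// ge0_fin_numE.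
have l0 : (0 <= l)%R by rewrite -lee_fin -nul.
have lx : (l <= x)%R by rewrite -lee_fin -nul.
have pmf k : P [set w | N w A = k%:R%:E] = (l ^+ k / k`!%:R * expR (- l))%:E.
  by rewrite Npmf// nul.
have cE : ~` count_ge m A = \big[setU/set0]_(k < m) [set w | N w A = k%:R%:E].
  rewrite -(bigcup_mkord _ (fun k : nat => [set w | N w A = k%:R%:E])).
  apply/seteqP; split => w /=.
    move=> /negP; rewrite -ltNge => h; case: (Nint w A mA) h => [->|[n Nn]].
      by rewrite ltNge leey.
    by rewrite Nn lte_fin ltr_nat => nm; exists n => /=.
  move=> [k /= km Nk]; rewrite /count_ge/= Nk; apply/negP.
  by rewrite -ltNge lte_fin ltr_nat.
have -> : count_ge m A = ~` (\big[setU/set0]_(k < m) [set w | N w A = k%:R%:E]).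
  by rewrite -cE setCK.
rewrite probability_setC; last first.
  by apply: bigsetU_measurable => k _; exact: measurable_count_eq.
rewrite measure_semi_additive_ord; last 3 first.
- by move=> k; exact: measurable_count_eq.
- move=> i j _ _ [w [/= Ni]]; rewrite Ni => -[] /eqP.
  by rewrite eqr_nat => /eqP ij; exact: val_inj.
- by apply: bigsetU_measurable => k _; exact: measurable_count_eq.
rewrite (eq_bigr (fun k : 'I_m => (l ^+ k / k`!%:R * expR (- l))%:E)); last first.
  by move=> k _; exact: pmf.
rewrite sumEFin -EFinB lee_fin -mulr_suml.
have h := expR_taylor_tail m l0.
have e0 := expR_gt0 (- l)%R.
have {}h := ler_wpM2r (ltW e0) h.
rewrite mulrBl -[leRHS]mulrA -expRD subrr expR0 mulr1 in h.
apply: le_trans h _.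
by rewrite ler_wpM2r ?invr_ge0// lerXn2r// nnegrE (le_trans l0).
Qed.

Lemma count0_le A (x : R) : measurable A -> nu A < +oo -> x%:E <= nu A ->
  P (~` count_ge 1 A) <= (expR (- x))%:E.
Proof.
case: N_poisson => Nint Npmf _ mA nuoo xnu.
have -> : ~` count_ge 1 A = [set w | N w A = 0%:R%:E].
  apply/seteqP; split => w /=.
    2: by move=> h; rewrite /count_ge/= h; apply/negP; rewrite lee_fin lern0.
  move=> h; apply: le_anti; rewrite measure_ge0 andbT; exact: count_ltP.
rewrite Npmf// expr0 fact0 divr1 mul1r lee_fin ler_expR lerN2.
have : nu A \is a fin_num.
  by rewrite ge0_fin_numE// integral_ge0// => p _; rewrite lee_fin invr_ge0 sqr_ge0.
by move=> /fineK h; rewrite -lee_fin h.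
Qed.

Definition all_hit (L : seq (set (R * R))) : set Omega :=
  [set w | forall i, (i < size L)%N -> count_ge 1 (nth set0 L i) w].

(** Beyond the end of the list [nth] returns [set0], so quantifying over all indices adds no
    constraint. *)
Definition disjoint_measurable (L : seq (set (R * R))) :=
  (forall i, measurable (nth set0 L i)) /\ trivIset setT (nth set0 L).

Lemma measurable_all_hit L : disjoint_measurable L -> measurable (all_hit L).
Proof.
move=> [mL _].
have -> : all_hit L = \bigcap_(i in `I_(size L)) count_ge 1 (nth set0 L i) by [].
by apply: bigcap_measurableType => i _; exact: measurable_count_ge.
Qed.

(** Independence over disjoint regions gives a product of probabilities, and the case [m = 1] of
    [count_ge_le] bounds each factor by the intensity. A region of infinite intensity is bounded
    trivially. *)
Lemma all_hit_le L : disjoint_measurable L ->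
  P (all_hit L) <= \prod_(A <- L) nu A.
Proof.
case: N_poisson => Nint Npmf Nind [mL tL].
have -> : all_hit L = \bigcap_(i in [set: 'I_(size L)])
    [set w | [set y : \bar R | 1%:E <= y] (N w (nth set0 L i))].
  apply/seteqP; split => w /=; first by move=> h i _; exact: h.
  by move=> h i iL; exact: (h (Ordinal iL)).
rewrite (Nind _ (fun i : 'I_(size L) => nth set0 L i)
  (fun=> [set y : \bar R | 1%:E <= y])); last 3 first.
- by [].
- by move=> i j _ _ h; apply: val_inj; exact: tL h.
- move=> _; have -> : [set y : \bar R | 1%:E <= y] = `[1%:E, +oo]%classic.
    by apply/seteqP; split => y /=; rewrite in_itv/= leey andbT.
  exact: emeasurable_itv.
rewrite (big_nth set0) big_mkord.
suff : forall I (r : seq I) (f g : I -> \bar R),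
    (forall i, 0 <= f i) -> (forall i, f i <= g i) ->
    \prod_(i <- r) f i <= \prod_(i <- r) g i.
  apply => i; first exact: measure_ge0.
  have nu0 : 0 <= nu (nth set0 L i).
    by apply: integral_ge0 => p _; rewrite lee_fin invr_ge0 sqr_ge0.
  have [->|[x nux]] : nu (nth set0 L i) = +oo \/ exists x, nu (nth set0 L i) = x%:E.
    by move: nu0; case: (nu _) => [x| |]// _; [right; exists x|left].
    by rewrite leey.
  have := @count_ge_le 1 _ x (mL i).
  by rewrite nux lexx expr1 factS fact0 divr1; apply.
move=> I r f g f0 fg; elim: r => [|i r ih]; first by rewrite !big_nil.
by rewrite !big_cons lee_pmul// prode_ge0.
Qed.

End PoissonCounts.

(** * Jump counts at dyadic scales *)

(* Time is cut at level [k] into [cells q k] cells of length [dy k ^+ q], and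
   jumps are called large when their mark exceeds [dy k ^+ e].  Integer powers
   of [dy k] replace the real powers [h ^ (1 +- epsilon)] of the classical
   argument, with [q] large in place of [epsilon] small. *)
Section Scales.
Variable R : realType.
Local Notation dy k := (2^-1 ^+ k : R).

Definition cells (q k : nat) : nat := (2 ^ (k * q))%N.

Lemma dy_gt0 k : 0 < dy k. Proof. exact: exprn_gt0. Qed.

Lemma dy_le1 k : dy k <= 1.
Proof. by apply: exprn_ile1 => //; lra. Qed.

Lemma cells_dy q k : (cells q k)%:R = (dy k ^+ q)^-1.
Proof. by rewrite natrX exprM -!exprVn invrK. Qed.

Lemma cellsS_le q k : (cells q k).+1%:R <= 2 / dy k ^+ q.
Proof.
have : (1 <= cells q k)%N by rewrite expn_gt0.
rewrite -(ler_nat R) -[(cells q k).+1%:R]natr1 cells_dy; lra.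
Qed.

Lemma dy_anti j k : (j <= k)%N -> dy k <= dy j.
Proof. by move=> jk; apply: ler_wiXn2l => //; lra. Qed.

Lemma dyD m n : dy (m + n) = dy m * dy n. Proof. exact: exprD. Qed.

Lemma dyDX p m n : dy (m + n) ^+ p = dy m ^+ p * dy n ^+ p.
Proof. by rewrite dyD; exact: exprMn. Qed.

Lemma dy_lt (x : R) : 0 < x -> exists l, dy l < x.
Proof.
move=> x0; exists (Num.truncn x^-1).+1.
rewrite exprVn -[ltRHS]invrK ltf_pV2 ?posrE ?exprn_gt0 ?invr_gt0//.
apply: lt_trans (truncnS_gt _) _.
by rewrite -natrX ltr_nat ltn_expl.
Qed.

(** The time 1 lies in the cell of index [cells q k], hence the non-strict bound on [i] and the
    [(cells q k).+1] indices in later union bounds. *)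
Lemma locate_cell q k t : 0 <= t -> exists i,
  [/\ i%:R * dy k ^+ q <= t, t < i.+1%:R * dy k ^+ q & t <= 1 -> (i <= cells q k)%N].
Proof.
move=> t0; have d0 := exprn_gt0 q (dy_gt0 k).
exists (Num.truncn (t / dy k ^+ q)).
have /andP[g1 g2] := truncn_itv (divr_ge0 t0 (ltW d0)).
split; [by rewrite -ler_pdivlMr|by rewrite -ltr_pdivrMr|move=> t1].
rewrite -(ler_nat R) cells_dy; apply: le_trans g1 _.
by rewrite ler_pdivrMr// mulVf ?gt_eqF.
Qed.

(** A cell with its two neighbours: it contains every point within one cell length of the cell. *)
Definition window q k (i : nat) : set R :=
  `[(i%:R - 1) * dy k ^+ q, (i%:R + 2) * dy k ^+ q].

Definition large e k : set R := `[dy k ^+ e, 1].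

(** The [j]-th octave of marks below the threshold [dy k ^+ e]. *)
Definition block e k j : set R :=
  `[dy k ^+ e * dy j.+1, 2 * (dy k ^+ e * dy j.+1)].

Lemma measurable_window q k i : measurable (window q k i).
Proof. exact: measurable_itv. Qed.

Lemma measurable_large e k : measurable (large e k).
Proof. exact: measurable_itv. Qed.

Lemma measurable_block e k j : measurable (block e k j).
Proof. exact: measurable_itv. Qed.

(** A jump at [t] itself is harmless: it separates the left limit from [X t] but does not move the
    path on either side. *)
Definition punctured (t r : R) : set R := `[t - r, t + r] `\ t.

Lemma measurable_punctured t r : measurable (punctured t r).
Proof. by apply: measurableD; [exact: measurable_itv|exact: measurable_set1]. Qed.

Lemma jump_intensity_large (a b : R) e k : a <= b ->
  (jump_intensity (`[a, b] `*` large e k) <= (2 * (b - a) / dy k ^+ e)%:E)%E.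
Proof. by move=> ab; rewrite /large -exprM; exact: jump_intensity_large_le. Qed.

Lemma jump_intensity_window q e k i :
  (jump_intensity (window q k i `*` large e k) <= (6 * dy k ^+ q / dy k ^+ e)%:E)%E.
Proof.
have d0 := exprn_gt0 q (dy_gt0 k).
apply: le_trans (jump_intensity_large _ _ _) _; first nra.
rewrite lee_fin le_eqVlt; apply/orP; left; apply/eqP.
by congr (_ / _); ring.
Qed.

End Scales.

#[local] Hint Resolve measurable_window measurable_large measurable_block
  measurable_punctured : core.

(** * Uniform almost sure bounds on jump counts *)

Section AlmostSure.
Context (R : realType) d (Omega : measurableType d) (P : probability Omega R).
Variable N : R.-ker Omega ~> (R * R)%type.
Hypothesis N_poisson : poisson_random_measure P (@jump_intensity R) N.
Local Notation nu := (@jump_intensity R).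
Local Notation dy k := (2^-1 ^+ k : R).
Local Notation count_ge := (count_ge N).

Let mcount m A : measurable A -> measurable (count_ge m A).
Proof. exact: measurable_count_ge. Qed.

(** Each rectangle has intensity at least [1 / (4 * dy k)], so it is empty with probability at most
    [expR (- 1 / (4 * dy k))]. Bounding this by a power of [dy k] of exponent [q + 1] pays for the
    [dy k ^- q] cells and leaves one factor [dy k]. *)
Lemma ae_jump_in_every_cell q :
  {ae P, forall w, exists K, forall k, (K <= k)%N ->
    forall i, (i < cells q k)%N ->
      count_ge 1 (`]i%:R * dy k ^+ q, i.+1%:R * dy k ^+ q] `*`
                  `[dy k ^+ q.+1, 2 * dy k ^+ q.+1]) w}.
Proof.
pose A k i : set (R * R) := `]i%:R * dy k ^+ q, i.+1%:R * dy k ^+ q] `*`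
                  `[dy k ^+ q.+1, 2 * dy k ^+ q.+1].
have mA k i : measurable (A k i) by apply: measurable_setX.
pose F k := [set w | exists2 i, (i < cells q k)%N & (~` count_ge 1 (A k i)) w].
have mF k : measurable (F k).
  have -> : F k = \bigcup_(i in `I_(cells q k)) ~` count_ge 1 (A k i) by [].
  by apply: bigcup_measurable => i _; apply: measurableC; exact: mcount.
have hF k : (P (F k) <= (q.+1`!%:R * 4 ^+ q.+1 * dy k)%:E)%E.
  have d0 := dy_gt0 R k; have dq0 := exprn_gt0 q d0.
  apply: (@le_trans _ _ ((cells q k)%:R * (q.+1`!%:R / (4 * dy k)^-1 ^+ q.+1))%:E); last first.
    rewrite lee_fin cells_dy; set x := dy k in d0 dq0 *.
    rewrite exprVn invrK exprMn (exprSr x).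
    rewrite le_eqVlt; apply/orP; left; apply/eqP; field; rewrite gt_eqF//.
  apply: measure_exists_lt => [j|j _]; first by apply: measurableC; exact: mcount.
  have ab : j%:R * dy k ^+ q <= j.+1%:R * dy k ^+ q by rewrite ler_wpM2r ?ler_nat// ltW.
  have nuge := jump_intensity_block_ge (mulr_ge0 (ler0n R j) (ltW dq0)) ab
    (exprn_gt0 q.+1 d0).
  have nufin : (nu (A k j) < +oo)%E.
    apply: (@le_lt_trans _ _
      ((j.+1%:R * dy k ^+ q - j%:R * dy k ^+ q) / dy k ^+ q.+1)%:E); last exact: ltry.
    apply: le_trans (jump_intensity_block_le ab (exprn_gt0 q.+1 d0)).
    apply: jump_intensityS => p [p1 p2]; split=> //.
    exact: subset_itv_oc_cc p1.
  apply: le_trans (count0_le N_poisson (mA k j) nufin nuge) _.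
  rewrite lee_fin; set x := (X in expR (- X)); have -> : x = (4 * dy k)^-1.
    rewrite /x -[j.+1%:R]natr1 (exprSr (dy k)); set u := dy k in d0 dq0 *.
    by field; rewrite !gt_eqF.
  by apply: expRN_le_pow; rewrite invr_gt0 mulr_gt0.
apply: filterS (ae_eventually_not mF (fun k _ => hF k)) => w [K hK].
exists K => k Kk i ik; apply: contrapT => h; apply: (hK k Kk); by exists i.
Qed.

(** The expected count is at most [6 * 2 ^+ j * dy k]. In the constant [q + 24], the term
    [24 = 6 * 4] exceeds [6 * expR 1], as [pow_div_fact_le] requires, and [q] pays for the number of
    cells. *)
Lemma ae_small_jump_counts q e : (e < q)%N ->
  {ae P, forall w, exists K, forall k, (K <= k)%N ->
    forall i j, (i <= cells q k)%N ->
      (N w (window q k i `*` block e k j)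
       <= ((q + 24) * 2 ^ j)%N%:R%:E)%E}.
Proof.
move=> eq.
pose A k i j : set (R * R) := window q k i `*` block e k j.
have mA k i j : measurable (A k i j) by apply: measurable_setX.
pose m j := ((q + 24) * 2 ^ j).+1%N.
pose G k j := [set w | exists2 i, (i < (cells q k).+1)%N & count_ge (m j) (A k i j) w].
have mG k j : measurable (G k j).
  have -> : G k j = \bigcup_(i in `I_(cells q k).+1) count_ge (m j) (A k i j) by [].
  by apply: bigcup_measurable => i _; exact: mcount.
have hG k j : (0 < k)%N -> (P (G k j) <= (2 * dy k * dy j)%:E)%E.
  move=> k0; have d0 := dy_gt0 R k; have dj0 := dy_gt0 R j; have d1 := dy_le1 R k.
  apply: (@le_trans _ _ ((cells q k).+1%:R * dy k ^+ m j)%:E).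
    apply: measure_exists_lt => [i|i _]; first exact: mcount.
    set c := dy k ^+ e * dy j.+1.
    have c0 : 0 < c by rewrite mulr_gt0// exprn_gt0.
    have dq0 := exprn_gt0 q d0.
    have nuA : (nu (A k i j) <= (6 * 2 ^+ j * dy k)%:E)%E.
      apply: le_trans (jump_intensity_block_le _ c0) _; first nra.
      rewrite lee_fin ler_pdivrMr//.
      have -> : (i%:R + 2) * dy k ^+ q - (i%:R - 1) * dy k ^+ q = 3 * dy k ^+ q by ring.
      have -> : 6 * 2 ^+ j * dy k * c = 3 * (dy k ^+ e.+1).
        have E : 2 ^+ j * dy j = 1 by rewrite -exprMn divff// expr1n.
        transitivity (3 * (2 ^+ j * dy j) * dy k ^+ e.+1); last by rewrite E mulr1.
        rewrite /c (exprS 2^-1) (exprS (dy k)).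
        by set u := dy k; set v := dy j; field.
      by rewrite ler_wpM2l// ler_wiXn2l// ltW.
    apply: le_trans (count_ge_le N_poisson (m j) (mA k i j) nuA) _.
    rewrite lee_fin; apply: pow_div_fact_le; [|exact: ltW|].
      by rewrite !mulr_ge0// ltW.
    have h4 := expR_le4 R.
    have hm : 24 * 2 ^+ j <= (m j)%:R :> R.
      rewrite -natrX -natrM ler_nat /m; nia.
    have p0 : 0 < 2 ^+ j :> R by exact: exprn_gt0.
    have -> : expR 1 * (6 * 2 ^+ j * dy k) = dy k * (expR 1 * (6 * 2 ^+ j)) by ring.
    rewrite ler_pM2l//; apply: le_trans hm.
    have -> : 24 * 2 ^+ j = 4 * (6 * 2 ^+ j) :> R by ring.
    by rewrite ler_wpM2r// mulr_ge0// ltW.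
  rewrite lee_fin.
  have hm : dy k ^+ m j <= dy k ^+ q * dy k * dy j.
    have -> : dy k ^+ q * dy k * dy j = dy k ^+ q.+1 * dy j by rewrite exprSr.
    apply: (@le_trans _ _ (dy k ^+ (q.+1 + j))).
      apply: ler_wiXn2l => //.
      have : (j < 2 ^ j)%N by exact: ltn_expl.
      rewrite /m; nia.
    (* Here [k > 0] turns [dy k ^+ j] into a factor at most [dy j], summable over the blocks. *)
    rewrite exprD ler_wpM2l//.
    rewrite -exprM; apply: dy_anti; exact: leq_pmull.
  have dq0 := exprn_gt0 q d0.
  apply: (@le_trans _ _ (2 / dy k ^+ q * (dy k ^+ q * dy k * dy j))).
    by apply: ler_pM => //; exact: cellsS_le.
  rewrite le_eqVlt; apply/orP; left; apply/eqP; field; rewrite gt_eqF//.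
pose F k := \bigcup_j G k j.
have mF k : measurable (F k) by exact: bigcup_measurable.
have hF k : (0 < k)%N -> (P (F k) <= (4 * dy k)%:E)%E.
  move=> k0; apply: le_trans (measure_bigcup_geometric (mG k) (fun j => hG k j k0)) _.
  by rewrite lee_fin; lra.
apply: filterS (ae_eventually_not mF hF) => w [K hK].
exists K => k Kk i j ik; apply: (count_ltP N_poisson (mA k i j)) => h.
by apply: (hK k Kk); exists j => //; exists i.
Qed.

(** For cells of length [h = dy k ^+ (2p + 2)] the threshold [dy k ^+ p] is slightly above
    [h ^ (1/2)]. The expected count is at most [6 * dy k ^+ p.+2]; half its square, times the number
    of cells, is of order [dy k ^+ 2]. *)
Lemma ae_at_most_one_large_jump p :
  {ae P, forall w, exists K, forall k, (K <= k)%N ->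
    forall i, (i <= cells p.+1.*2 k)%N ->
      (N w (window p.+1.*2 k i `*` large p k) <= 1%:E)%E}.
Proof.
pose q := p.+1.*2; rewrite -/q.
pose A k i : set (R * R) := window q k i `*` large p k.
have mA k i : measurable (A k i) by apply: measurable_setX.
pose F k := [set w | exists2 i, (i < (cells q k).+1)%N & count_ge 2 (A k i) w].
have mF k : measurable (F k).
  have -> : F k = \bigcup_(i in `I_(cells q k).+1) count_ge 2 (A k i) by [].
  by apply: bigcup_measurable => i _; exact: mcount.
have hF k : (P (F k) <= (36 * dy k)%:E)%E.
  have d0 := dy_gt0 R k; have d1 := dy_le1 R k.
  have dq0 := exprn_gt0 q d0; have dp0 := exprn_gt0 p d0.
  apply: (@le_trans _ _ ((cells q k).+1%:R * ((6 * dy k ^+ p.+2) ^+ 2 / 2`!%:R))%:E).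
    apply: measure_exists_lt => [i|i _]; first exact: mcount.
    apply: count_ge_le => //; apply: le_trans (jump_intensity_window _ _ _ _ _) _.
    rewrite lee_fin -mulrA ler_wpM2l// ler_pdivrMr// -exprD.
    by have -> : (q = p.+2 + p)%N by rewrite /q; lia.
  rewrite lee_fin; apply: (@le_trans _ _ (2 / dy k ^+ q * ((6 * dy k ^+ p.+2) ^+ 2 / 2`!%:R))).
    rewrite ler_wpM2r ?cellsS_le// divr_ge0// sqr_ge0.
  have -> : (6 * dy k ^+ p.+2) ^+ 2 = 36 * dy k ^+ q * dy k ^+ 2.
    rewrite exprMn -exprM -mulrA -exprD.
    have -> : (p.+2 * 2 = q + 2)%N by rewrite /q; lia.
    by congr (_ * _); rewrite -natrX.
  have -> : 2 / dy k ^+ q * (36 * dy k ^+ q * dy k ^+ 2 / 2`!%:R) = 36 * dy k ^+ 2.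
    by rewrite (_ : 2`!%:R = 2 :> R)//; field; rewrite gt_eqF.
  rewrite expr2; nra.
apply: filterS (ae_eventually_not mF (fun k _ => hF k)) => w [K hK].
exists K => k Kk i ik; apply: (count_ltP (m := 1) N_poisson (mA k i)) => h.
by apply: (hK k Kk); exists i.
Qed.

(** At the times 0 and 1 only one side is available, so that side has to be free of large jumps.
    There are only two intervals per level, so an expected count of order [dy k] suffices. *)
Lemma ae_no_large_jump_near_ends q e : (e < q)%N ->
  {ae P, forall w, exists K, forall k, (K <= k)%N ->
      (N w (`[0%R, (dy k ^+ q)%R] `*` large e k) <= 0)%E /\
      (N w (`[(1 - dy k ^+ q)%R, 1%R] `*` large e k) <= 0)%E}.
Proof.
move=> eq.
pose A k : set (R * R) := `[0, dy k ^+ q] `*` large e k.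
pose B k : set (R * R) := `[1 - dy k ^+ q, 1] `*` large e k.
have mA k : measurable (A k) by apply: measurable_setX.
have mB k : measurable (B k) by apply: measurable_setX.
pose F k := count_ge 1 (A k) `|` count_ge 1 (B k).
have mF k : measurable (F k) by apply: measurableU; exact: mcount.
have hF k : (P (F k) <= (4 * dy k)%:E)%E.
  have d0 := dy_gt0 R k; have d1 := dy_le1 R k.
  have dq0 := exprn_gt0 q d0; have de0 := exprn_gt0 e d0.
  have x : 2 * dy k ^+ q / dy k ^+ e <= 2 * dy k.
    rewrite -mulrA ler_wpM2l// ler_pdivrMr// -exprS.
    by apply: ler_wiXn2l.
  have one A' : measurable A' -> (nu A' <= (2 * dy k ^+ q / dy k ^+ e)%:E)%E ->
      (P (count_ge 1 A') <= (2 * dy k)%:E)%E.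
    move=> mA' nuA'; apply: le_trans (count_ge_le N_poisson 1 mA' nuA') _.
    by rewrite lee_fin expr1 divr1.
  apply: le_trans (measureU2 _ (mcount _ (mA k)) (mcount _ (mB k))) _.
  apply: (@le_trans _ _ ((2 * dy k)%:E + (2 * dy k)%:E)%E); last by rewrite -EFinD lee_fin; lra.
  apply: leeD; apply: one => //; apply: le_trans (jump_intensity_large _ _ _) _.
  - exact: ltW.
  - by rewrite subr0.
  - by rewrite lerBlDl lerDr ltW.
  - by rewrite opprB addrCA subrr addr0.
apply: filterS (ae_eventually_not mF (fun k _ => hF k)) => w [K hK].
exists K => k Kk; split.
  by apply: (count_ltP (m := 0) N_poisson (mA k)) => h; apply: (hK k Kk); left.
by apply: (count_ltP (m := 0) N_poisson (mB k)) => h; apply: (hK k Kk); right.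
Qed.

End AlmostSure.

(** * Times approached by large jumps at all scales *)

Section Chains.
Context (R : realType) d (Omega : measurableType d) (P : probability Omega R).
Variable N : R.-ker Omega ~> (R * R)%type.
Hypothesis N_poisson : poisson_random_measure P (@jump_intensity R) N.
Local Notation nu := (@jump_intensity R).
Local Notation dy k := (2^-1 ^+ k : R).
Local Notation count_ge := (count_ge N).
Local Notation all_hit := (all_hit N).
Variable e : nat.
Local Notation q := e.+1.

Definition collar (m n i : nat) : set R :=
  `[i%:R * dy n ^+ q - dy m ^+ q, i.+1%:R * dy n ^+ q + dy m ^+ q] `\` window q n i.

(* [chain J k i] stands for: some time of the [i]-th cell of level [k] is
   approached by [J + 1] successively closer large jumps.  The closest jump at
   distance about [dy (k + l) ^+ q] lies in the collar of the cell of level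
   [k + l + 2]; skipping one level makes this collar disjoint from the window
   that carries the rest of the chain. *)
Fixpoint chain (J k i : nat) : set Omega :=
  if J is J'.+1 then
    \bigcup_l [set w | exists2 j, (j < cells q l.+2)%N &
      (count_ge 1 (collar (k + l) (k + l.+2) (i * cells q l.+2 + j) `*` large e k)
       `&` chain J' (k + l.+2) (i * cells q l.+2 + j)) w]
  else count_ge 1 (window q k i `*` large e k).

Lemma measurable_collar m n i : measurable (collar m n i).
Proof. by apply: measurableD; [exact: measurable_itv|exact: measurable_window]. Qed.
#[local] Hint Resolve measurable_collar : core.

Lemma measurable_chain J k i : measurable (chain J k i).
Proof.
elim: J k i => [|J ih] k i /=.
  by apply: measurable_count_ge; apply: measurable_setX.
apply: bigcup_measurable => l _.
set F := fun j => count_ge 1 (collar (k + l) (k + l.+2) (i * cells q l.+2 + j) `*` large e k)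
       `&` chain J (k + l.+2) (i * cells q l.+2 + j).
have -> : [set w | exists2 j, (j < cells q l.+2)%N & F j w] =
  \bigcup_(j in `I_(cells q l.+2)) F j by [].
apply: bigcup_measurable => j _; apply: measurableI; last exact: ih.
by apply: measurable_count_ge; apply: measurable_setX.
Qed.

Lemma all_hit_cons A L : all_hit (A :: L) = count_ge 1 A `&` all_hit L.
Proof.
apply/seteqP; split => w /=.
  by move=> h; split; [exact: (h 0%N)|move=> j jL; exact: (h j.+1)].
by move=> [h0 h] [|j]//= jL; exact: h.
Qed.

Lemma disjoint_measurable_cons (A : set (R * R)) L : measurable A -> disjoint_measurable L ->
  (forall j, A `&` nth set0 L j = set0) -> disjoint_measurable (A :: L).
Proof.
move=> mA [mL tL] AL; split; first by case=> [|j]//=.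
move=> [|i] [|j] _ _ //=.
- by rewrite AL => -[].
- by rewrite setIC AL => -[].
- by move=> h; congr _.+1; exact: tL h.
Qed.

(** The cell [i] of level [k] starts where its first descendant of level [k + l + 2] starts. *)
Lemma cells_children_dy k l i : i%:R * dy k ^+ q = (i * cells q l.+2)%:R * dy (k + l.+2) ^+ q.
Proof.
rewrite natrM cells_dy dyDX; set x := dy l.+2 ^+ q.
have x0 : x != 0 by rewrite gt_eqF// exprn_gt0// dy_gt0.
set y := dy k ^+ q; by field.
Qed.

(** Everything a chain looks at stays in the window of its starting cell; this keeps it disjoint
    from the regions hit earlier. *)
Lemma child_window k l i j : (j < cells q l.+2)%N ->
  (window q (k + l.+2) (i * cells q l.+2 + j) : set R) `<=` window q k i /\
  collar (k + l) (k + l.+2) (i * cells q l.+2 + j) `<=` window q k i.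
Proof.
move=> jl.
set n := (k + l.+2)%N; set g := (i * cells q l.+2 + j)%N.
have dk0 := exprn_gt0 q (dy_gt0 R k); have dn0 := exprn_gt0 q (dy_gt0 R n).
have glo : i%:R * dy k ^+ q <= g%:R * dy n ^+ q.
  by rewrite (cells_children_dy k l i) ler_wpM2r// ler_nat leq_addr.
have ghi : g.+1%:R * dy n ^+ q <= i.+1%:R * dy k ^+ q.
  rewrite (cells_children_dy k l i.+1) ler_wpM2r// ler_nat /g mulSn; lia.
have nk : dy n ^+ q <= dy k ^+ q by rewrite lerXn2r ?nnegrE// dy_anti// leq_addr.
have mk : dy (k + l) ^+ q <= dy k ^+ q by rewrite lerXn2r ?nnegrE// dy_anti// leq_addr.
rewrite -[i.+1%:R]natr1 -[g.+1%:R]natr1 in ghi.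
split=> s.
  rewrite /window /= !in_itv/= => /andP[s1 s2]; apply/andP; split; nra.
rewrite /collar /window -[g.+1%:R]natr1 => -[]; rewrite /= !in_itv/= => /andP[s1 s2] _.
apply/andP; split; nra.
Qed.

(** Each link costs 6 for the intensity of a collar, [4 ^+ q] for the two extra levels in the number
    of descendants, and 2 for the geometric sum over [l]. *)
Fixpoint chain_cst (J : nat) : R :=
  if J is J'.+1 then 12 * 4 ^+ q * chain_cst J' else 6.

Lemma chain_cst_ge0 J : 0 <= chain_cst J.
Proof. by elim: J => //= J ih; rewrite !mulr_ge0. Qed.

(* The list [L] collects the regions hit earlier in the chain; keeping them
   disjoint from the current window turns independence into a product. *)
Lemma chain_le J L k i (x : R) : disjoint_measurable L ->
  (forall j, nth set0 L j `&` (window q k i `*` setT) = set0) ->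
  (\prod_(A <- L) nu A <= x%:E)%E -> 0 <= x ->
  (P (all_hit L `&` chain J k i) <= (x * (chain_cst J * dy k ^+ J.+1))%:E)%E.
Proof.
elim: J L k i x => [|J ih] L k i x dL Lw Lx x0 /=.
  pose A : set (R * R) := window q k i `*` large e k.
  have dAL : disjoint_measurable (A :: L).
    apply: disjoint_measurable_cons => //; first exact: measurable_setX.
    by move=> j; rewrite -subset0 => p [[p1 p2] Lp]; rewrite -(Lw j); split.
  rewrite setIC -all_hit_cons; apply: le_trans (all_hit_le N_poisson dAL) _.
  rewrite big_cons expr1.
  have nuA : (nu A <= (6 * dy k)%:E)%E.
    apply: le_trans (jump_intensity_window _ _ _ _ _) _.
    rewrite lee_fin exprS -!mulrA divff ?mulr1//.
  have nu0 B : (0 <= nu B)%E by apply: integral_ge0 => p _; rewrite lee_fin invr_ge0 sqr_ge0.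
  rewrite mulrC EFinM; apply: lee_pmul => //; exact: prode_ge0.
rewrite setI_bigcupr.
have d0 := dy_gt0 R k.
pose c := x * (6 * 4 ^+ q * chain_cst J * dy k ^+ J.+2).
have -> : x * (12 * 4 ^+ q * chain_cst J * dy k ^+ J.+2) = 2 * c by rewrite /c; ring.
pose A l j : set (R * R) :=
  collar (k + l) (k + l.+2) (i * cells q l.+2 + j) `*` large e k.
have mA l j : measurable (A l j) by apply: measurable_setX.
pose G l j := all_hit L `&` (count_ge 1 (A l j) `&` chain J (k + l.+2) (i * cells q l.+2 + j)).
have mG l j : measurable (G l j).
  apply: measurableI; first exact: measurable_all_hit.
  by apply: measurableI; [exact: measurable_count_ge|exact: measurable_chain].
pose F l := [set w | exists2 j, (j < cells q l.+2)%N & G l j w].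
have FE l : all_hit L `&` [set w | exists2 j, (j < cells q l.+2)%N &
      (count_ge 1 (A l j) `&` chain J (k + l.+2) (i * cells q l.+2 + j)) w] = F l.
  apply/seteqP; split => w /=; first by move=> [h [j jl hj]]; exists j.
  by move=> [j jl [h hj]]; split=> //; exists j.
under eq_bigcupr do rewrite FE.
apply: measure_bigcup_geometric => [l|l].
  have -> : F l = \bigcup_(j in `I_(cells q l.+2)) G l j by [].
  exact: bigcup_measurable.
have dl0 := dy_gt0 R l.
(* A bound for the intensity of each region [A l j]. *)
pose y := 6 * dy (k + l) ^+ q / dy k ^+ e.
have y0 : 0 <= y by rewrite divr_ge0// mulr_ge0.
apply: (@le_trans _ _ ((cells q l.+2)%:R * (y * x * (chain_cst J * dy (k + l.+2) ^+ J.+1)))%:E).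
  apply: measure_exists_lt => // j jl.
  have [w1 w2] := child_window k i jl.
  have dAL : disjoint_measurable (A l j :: L).
    apply: disjoint_measurable_cons => // j'.
    by rewrite -subset0 => p [[/w2 p1 p2] Lp]; rewrite -(Lw j'); split.
  have -> : G l j = all_hit (A l j :: L) `&` chain J (k + l.+2) (i * cells q l.+2 + j).
    by rewrite all_hit_cons /G setIA [all_hit L `&` _]setIC.
  apply: ih => //; last by rewrite mulr_ge0.
    (* The new collar avoids the window of the child by definition; the older regions avoid the
       window of the parent, which contains it. *)
    case=> [|j'] /=.
      by rewrite -subset0 => p [[[_ nw] _] [/nw]].
    by rewrite -subset0 => p [Lp [/w1 p1 p2]]; rewrite -(Lw j'); split.
  rewrite big_cons EFinM.
  have nu0 B : (0 <= nu B)%E by apply: integral_ge0 => p _; rewrite lee_fin invr_ge0 sqr_ge0.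
  apply: lee_pmul => //; first exact: prode_ge0.
  set g := (i * cells q l.+2 + j)%N.
  have dn : dy (k + l.+2) ^+ q <= dy (k + l) ^+ q.
    by rewrite lerXn2r ?nnegrE// dy_anti// leq_add2l; lia.
  have dm0 : 0 < dy (k + l) ^+ q by rewrite exprn_gt0// dy_gt0.
  have dn0 : 0 < dy (k + l.+2) ^+ q by rewrite exprn_gt0// dy_gt0.
  (* The collar with its hole filled in: an interval of length at most [3 * dy (k + l) ^+ q]. *)
  pose B : set R := `[g%:R * dy (k + l.+2) ^+ q - dy (k + l) ^+ q,
     g.+1%:R * dy (k + l.+2) ^+ q + dy (k + l) ^+ q]%classic.
  apply: (@le_trans _ _ (nu (B `*` large e k))).
    by apply: jump_intensityS => p [[p1 _] p2].
  rewrite /B -[g.+1%:R]natr1.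
  apply: le_trans (jump_intensity_large _ _ _) _; first nra.
  rewrite lee_fin /y ler_wpM2r ?invr_ge0//; nra.
have dl4 : dy l.+2 = dy l / 4 by rewrite !exprS; set u := dy l; field.
rewrite lee_fin cells_dy /y /c !dyDX dl4 !expr_div_n.
have c0 := chain_cst_ge0 J.
(* The number of descendants cancels [dy l ^+ q] in the intensity of the collar; this factor, left
   over from the rest of the chain, makes the sum over [l] converge. *)
have lJ : dy l ^+ J.+1 / 4 ^+ J.+1 <= dy l.
  rewrite -expr_div_n exprS; apply: (@le_trans _ _ (dy l / 4 * 1)); last nra.
  rewrite ler_wpM2l ?divr_ge0// exprn_ile1// ?divr_ge0//.
  have := dy_le1 R l; lra.
have -> : (dy l ^+ q / 4 ^+ q)^-1 * (6 * (dy k ^+ q * dy l ^+ q) / dy k ^+ e * x *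
    (chain_cst J * (dy k ^+ J.+1 * (dy l ^+ J.+1 / 4 ^+ J.+1)))) =
  x * (6 * 4 ^+ q * chain_cst J * dy k ^+ J.+2) * (dy l ^+ J.+1 / 4 ^+ J.+1).
  have E1 : dy k ^+ q = dy k * dy k ^+ e by rewrite exprS.
  have E2 : dy k ^+ J.+2 = dy k * dy k ^+ J.+1 by rewrite exprS.
  rewrite E1 E2.
  have h1 : dy k ^+ e != 0 by rewrite gt_eqF// exprn_gt0.
  have h2 : dy l ^+ q != 0 by rewrite gt_eqF// exprn_gt0.
  have h3 : 4 ^+ q != 0 :> R by rewrite gt_eqF// exprn_gt0.
  have h4 : 4 ^+ J.+1 != 0 :> R by rewrite gt_eqF// exprn_gt0.
  set u1 := dy k ^+ e in h1 *; set u2 := dy l ^+ q in h2 *.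
  set u3 := 4 ^+ q in h3 *; set u4 := 4 ^+ J.+1 in h4 *.
  set u5 := dy k; set u6 := u5 ^+ J.+1; set u7 := dy l ^+ J.+1.
  by field; rewrite h1 h2 h3 h4.
have p : 0 <= dy k ^+ J.+2 by exact: exprn_ge0 (ltW d0).
rewrite ler_wpM2l//; do 2! [apply: mulr_ge0 => //]; exact: mulr_ge0.
Qed.

(** The large jump near [t] at level [k] lies in some shell around [t]; the shell determines [l],
    and the chain goes on from the cell of level [k + l + 2] that contains [t]. *)
Lemma bad_time_chain w k i (t : R) :
  i%:R * dy k ^+ q <= t < i.+1%:R * dy k ^+ q ->
  (forall m, (k <= m)%N ->
    count_ge 1 (punctured t (dy m ^+ q) `*` large e m) w) ->
  forall J, chain J k i w.
Proof.
move=> ti bad J; elim: J k i ti bad => [|J ih] k i /andP[it ti] bad /=.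
  apply: le_trans (bad k (leqnn k)) _; apply: le_measure; rewrite ?inE.
  - by apply: measurable_setX.
  - exact: measurable_setX.
  move=> [s z] [/= [+ _] zl]; rewrite /= in_itv/= => /andP[s1 s2]; split=> //=.
  rewrite /window/= in_itv/=; rewrite -[i.+1%:R]natr1 in ti; apply/andP; split; nra.
pose D l : set R := [set s | dy (k + l.+1) ^+ q < `|s - t| <= dy (k + l) ^+ q].
have DE l : D l = `[t - dy (k + l) ^+ q, t + dy (k + l) ^+ q] `\`
    `[t - dy (k + l.+1) ^+ q, t + dy (k + l.+1) ^+ q].
  apply/seteqP; split => s; rewrite /D /= !in_itv/= -!ler_distlC distrC.
    by move=> /andP[s1 ->]; split=> //; apply/negP; rewrite -ltNge.
  by move=> [-> /negP]; rewrite -ltNge => ->.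
have mD l : measurable (D l) by rewrite DE; apply: measurableD; exact: measurable_itv.
have [l hl] : exists l, count_ge 1 (D l `*` large e k) w.
  apply: contrapT => /forallNP h.
  have hb : (1%:R%:E <= N w _)%E := bad k (leqnn k).
  move: hb; apply/negP; rewrite -ltNge.
  apply: (@le_lt_trans _ _ 0%E); last by rewrite lte_fin ltr01.
  (* The shells shrink to [t], which is removed, so they cover the punctured interval. *)
  have sub : punctured t (dy k ^+ q) `*` (large e k : set R) `<=`
      \bigcup_l (D l `*` large e k).
    move=> p [[+ s2] zl]; rewrite /= in_itv/= -ler_distlC distrC => s1.
    set s := p.1 in s1 s2.
    have st : 0 < `|s - t| by rewrite normr_gt0 subr_eq0; apply/eqP.
    have ex : exists l, dy (k + l.+1) ^+ q < `|s - t|.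
      have [l hl] := dy_lt st; exists l; apply: le_lt_trans hl.
      rewrite -exprM; apply: dy_anti; nia.
    case: (ex_minnP ex) => l hl lmin; exists l => //; split=> //=; rewrite /D/= hl/=.
    case: l hl lmin => [|l] hl lmin; first by rewrite addn0.
    by rewrite leNgt; apply/negP => /lmin; rewrite ltnn.
  apply: le_trans (measure_sigma_subadditive _ _ _ sub) _.
  - by move=> l; exact: measurable_setX.
  - by apply: measurable_setX.
  rewrite eseries0// => l _ _; apply/eqP; rewrite eq_le measure_ge0 andbT.
  apply: (count_ltP (m := 0) N_poisson); [exact: measurable_setX|exact: h].
exists l => //.
have dn0 : 0 < dy (k + l.+2) ^+ q by rewrite exprn_gt0// dy_gt0.
have t0 : 0 <= t by apply: le_trans it; rewrite mulr_ge0// exprn_ge0.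
have [g [g1 g2 _]] := locate_cell q (k + l.+2) t0.
have gi : (i * cells q l.+2 <= g)%N.
  have : (i * cells q l.+2)%:R * dy (k + l.+2) ^+ q < g.+1%:R * dy (k + l.+2) ^+ q.
    by rewrite -cells_children_dy; exact: le_lt_trans g2.
  by rewrite ltr_pM2r// ltr_nat ltnS.
have gi' : (g < i.+1 * cells q l.+2)%N.
  have : g%:R * dy (k + l.+2) ^+ q < (i.+1 * cells q l.+2)%:R * dy (k + l.+2) ^+ q.
    by rewrite -cells_children_dy; exact: le_lt_trans ti.
  by rewrite ltr_pM2r// ltr_nat.
exists (g - i * cells q l.+2)%N; first by move: gi'; rewrite mulSn; lia.
rewrite subnKC//; split; last first.
  apply: ih; first by rewrite g1 g2.
  by move=> m km; apply: bad; apply: leq_trans km; exact: leq_addr.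
apply: le_trans hl _; apply: le_measure; rewrite ?inE.
- exact: measurable_setX.
- by apply: measurable_setX.
move=> [s z] [/= /andP[s1 s2] zl]; split=> //=.
rewrite ler_norml in s2; move/andP: s2 => [s2 s3].
split; first by rewrite /= in_itv/=; apply/andP; split; lra.
rewrite /window/= in_itv/= => /andP[s4 s5].
suff : `|s - t| <= dy (k + l.+1) ^+ q by rewrite leNgt s1.
(* A point of the window is at distance at most two cell lengths from [t], hence inside the inner
   radius of the shell. *)
have h : 2 * dy (k + l.+2) ^+ q <= dy (k + l.+1) ^+ q.
  rewrite addnS.
  set m := (k + l.+1)%N; rewrite (exprS 2^-1 m) exprMn exprS.
  have a0 : 0 <= dy m ^+ q by rewrite exprn_ge0.
  have a1 : 2^-1 ^+ e <= 1 :> R := dy_le1 R e.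
  set a := dy m ^+ q in a0 *; set b := 2^-1 ^+ e in a1 *; nra.
rewrite -[g.+1%:R]natr1 in g2.
rewrite ler_norml; apply/andP; split; nra.
Qed.

(** Chains of depth [q] have probability of order [dy k ^+ q.+1], which beats the [dy k ^- q] cells
    by one factor [dy k]. *)
Lemma ae_no_persistently_bad_time :
  {ae P, forall w, forall t : R, 0 <= t <= 1 -> forall k0, exists2 k, (k0 <= k)%N &
    (N w (punctured t (dy k ^+ q) `*` large e k) <= 0)%E}.
Proof.
pose F k := [set w | exists2 i, (i < (cells q k).+1)%N & chain q k i w].
have mF k : measurable (F k).
  have -> : F k = \bigcup_(i in `I_(cells q k).+1) chain q k i by [].
  by apply: bigcup_measurable => i _; exact: measurable_chain.
have hF k : (P (F k) <= (2 * chain_cst q * dy k)%:E)%E.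
  have d0 := dy_gt0 R k; have dq0 := exprn_gt0 q d0.
  apply: (@le_trans _ _ ((cells q k).+1%:R * (1 * (chain_cst q * dy k ^+ q.+1)))%:E).
    apply: measure_exists_lt => [i|i _]; first exact: measurable_chain.
    have := @chain_le q [::] k i 1; rewrite big_nil (_ : all_hit [::] = setT); last first.
      by apply/seteqP; split.
    rewrite setTI; apply=> //; last by move=> j; rewrite nth_nil set0I.
    by split=> [j|]; [rewrite nth_nil|move=> a b _ _ []; rewrite nth_nil => ? []].
  rewrite lee_fin; apply: (@le_trans _ _ (2 / dy k ^+ q * (1 * (chain_cst q * dy k ^+ q.+1)))).
    by rewrite ler_wpM2r ?cellsS_le// mul1r mulr_ge0 ?chain_cst_ge0// exprn_ge0// ltW.
  rewrite le_eqVlt; apply/orP; left; apply/eqP; rewrite (exprSr (dy k) q).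
  set u := dy k ^+ q in dq0 *; set v := dy k; field; rewrite gt_eqF//.
apply: filterS (ae_eventually_not mF (fun k _ => hF k)) => w [K hK] t /andP[t0 t1] k0.
apply: contrapT => /forall2NP h.
pose k := maxn K k0; apply: (hK k (leq_maxl _ _)).
have [i [g1 g2 ic]] := locate_cell q k t0.
exists i; first by rewrite ltnS ic.
apply: (@bad_time_chain w k i t); first by rewrite g1.
move=> m km; have [|hm] := h m; first by move/negP; rewrite (leq_trans (leq_maxr K k0) km).
apply: contrapT => nc; apply: hm.
apply: (count_ltP (m := 0) N_poisson) nc.
by apply: measurable_setX.
Qed.

End Chains.

(** * Local dimensions from masses at geometric scales *)

Section LocalDimension.
Context (R : realType) (m : set R -> \bar R) (x : R).
Hypothesis m_gt0 : forall r, 0 < r -> (0 < m (ball x r))%E.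
Hypothesis m_fin : forall r, m (ball x r) \is a fin_num.

Lemma lower_local_dim_ge (c delta : R) : 0 < delta ->
  (forall r, 0 < r -> r < delta -> (c%:E <= log_mass_ratio m x r)%E) ->
  (c%:E <= lower_local_dim m x)%E.
Proof.
move=> d0 h; rewrite /lower_local_dim limf_einfE.
pose A := [set r : R | 0 < r < delta].
apply: le_trans (ereal_sup_ubound _); last first.
  exists A => //; near=> r; rewrite /A/=; apply/andP; split; near: r.
    exact: nbhs_right_gt.
  exact: nbhs_right_lt.
by apply: le_ereal_inf_tmp => _ [r /andP[r0 rd] <-]; exact: h.
Unshelve. all: end_near. Qed.

Lemma upper_local_dim_le (c delta : R) : 0 < delta ->
  (forall r, 0 < r -> r < delta -> (log_mass_ratio m x r <= c%:E)%E) ->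
  (upper_local_dim m x <= c%:E)%E.
Proof.
move=> d0 h; rewrite /upper_local_dim limf_esupE.
pose A := [set r : R | 0 < r < delta].
apply: le_trans (ereal_inf_lbound _) _.
  exists A => //; near=> r; rewrite /A/=; apply/andP; split; near: r.
    exact: nbhs_right_gt.
  exact: nbhs_right_lt.
by apply: ge_ereal_sup => _ [r /andP[r0 rd] <-]; exact: h.
Unshelve. all: end_near. Qed.

Lemma lower_local_dim_le (c : R) :
  (forall delta, 0 < delta ->
     exists r, [/\ 0 < r, r < delta & (log_mass_ratio m x r <= c%:E)%E]) ->
  (lower_local_dim m x <= c%:E)%E.
Proof.
move=> h; rewrite /lower_local_dim limf_einfE.
apply: ge_ereal_sup => _ [A FA <-].
have [delta /= d0 dA] := FA.
have [r [r0 rd hr]] := h _ d0.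
apply: le_trans hr; apply: ereal_inf_lbound; exists r => //; apply: dA => //=.
by rewrite sub0r normrN ger0_norm// ltW.
Qed.

Lemma lower_le_upper_local_dim : (lower_local_dim m x <= upper_local_dim m x)%E.
Proof.
rewrite /lower_local_dim /upper_local_dim limf_einfE limf_esupE.
apply: ge_ereal_sup => _ [A FA <-]; apply: le_ereal_inf_tmp => _ [B FB <-].
have /filter_ex[r [Ar Br]] : (0^'+ : set_system R) (A `&` B) by exact: filterI.
apply: (@le_trans _ _ (log_mass_ratio m x r)).
  by apply: ereal_inf_lbound; exists r.
by apply: ereal_sup_ubound; exists r.
Qed.

Let mE r : m (ball x r) = (fine (m (ball x r)))%:E. Proof. by rewrite fineK. Qed.

(** The level [k] is the largest with [2 * r <= expR (- (k * B))]. Rounding and the constants 2 and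
    4 change [- ln] of the mass by a bounded amount, which [eps * (- ln r)] absorbs for small
    [r]. *)
Lemma lower_local_dim_ge_scales (A B delta eps : R) (K : nat) :
  0 < A -> 0 < B -> 0 < delta -> 0 < eps ->
  (forall k r, (K <= k)%N -> 0 < r -> r <= delta -> 2 * r <= expR (- (k%:R * B)) ->
     (m (ball x r) <= (4 * expR (- (k%:R * A)))%:E)%E) ->
  ((A / B - eps)%:E <= lower_local_dim m x)%E.
Proof.
move=> A0 B0 d0 e0 h.
have AB0 : 0 < A / B by rewrite divr_gt0.
have l2 : 0 < ln 2 :> R by rewrite ln_gt0// ltr1n.
have l4 : 0 < ln 4 :> R by rewrite ln_gt0// ltr1n.
(* A threshold for [- ln r]: the term [K * B] forces [k >= K], and the quotient by [eps] absorbs the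
   constants. *)
pose Y := 1 + ln 2 + K%:R * B + (ln 4 + A + A / B * ln 2) / eps.
apply: (@lower_local_dim_ge _ (Num.min delta (expR (- Y)))); first by rewrite lt_min d0 expR_gt0.
move=> r r0; rewrite lt_min => /andP[rd rY].
have lY : Y < - ln r.
  by rewrite ltrNr -[ltRHS](expRK) ltr_ln ?posrE ?expR_gt0.
set L := - ln r in lY.
have e1 : 0 < (ln 4 + A + A / B * ln 2) / eps by rewrite divr_gt0 ?addr_gt0// mulr_gt0.
have KB : 0 <= K%:R * B by rewrite mulr_ge0// ltW.
have L0 : 0 < L by apply: lt_trans lY; rewrite /Y; lra.
rewrite /log_mass_ratio lee_fin.
set v := fine (m (ball x r)).
have v0 : 0 < v by rewrite -lte_fin /v -mE m_gt0.
have -> : ln v / ln r = (- ln v) / L by rewrite /L invrN mulrNN.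
rewrite ler_pdivlMr//.
pose y := L - ln 2.
have y0 : 0 <= y by rewrite /y; rewrite /Y in lY; lra.
pose k := Num.truncn (y / B).
have /andP[k1 k2] := truncn_itv (divr_ge0 y0 (ltW B0)).
rewrite -/k in k1 k2; rewrite ler_pdivlMr// in k1; rewrite ltr_pdivrMr// in k2.
have Kk : (K <= k)%N.
  rewrite truncn_ge_nat ?divr_ge0 ?(ltW B0)// ler_pdivlMr// /y; rewrite /Y in lY; lra.
have vle : v <= 4 * expR (- (k%:R * A)).
  rewrite -lee_fin /v -mE; apply: h => //; first exact: ltW.
  rewrite -[leLHS]lnK ?posrE ?mulr_gt0// ler_expR lnM ?posrE//.
  by rewrite lerNr opprD addrC; apply: le_trans k1 _; rewrite /y /L; lra.
have lv : ln v <= ln 4 - k%:R * A.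
  have := vle; rewrite -ler_ln ?posrE ?mulr_gt0 ?expR_gt0//.
  by rewrite lnM ?posrE ?expR_gt0// expRK.
rewrite -[k.+1%:R]natr1 in k2.
have yAB : y * (A / B) < (k%:R + 1) * A.
  by rewrite mulrCA -[ltRHS]mulrC ltr_pM2l// ltr_pdivrMr.
have eL : ln 4 + A + A / B * ln 2 <= eps * L.
  rewrite [eps * L]mulrC -ler_pdivrMr//; apply: ltW; apply: le_lt_trans lY; rewrite /Y; lra.
rewrite /y in yAB; lra.
Qed.

Section Mass_ge.
Variables (A B C eps : R).
Hypotheses (A0 : 0 < A) (B0 : 0 < B) (C0 : 0 < C) (eps_gt0 : 0 < eps).

Lemma ratio_le (k : nat) r a : r < 1 -> 0 < r ->
  expR (- (k%:R * A)) <= fine (m (ball x r)) -> k%:R * A <= a * (- ln r) ->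
  (log_mass_ratio m x r <= a%:E)%E.
Proof.
move=> r1 r0 vge ka; rewrite /log_mass_ratio lee_fin; set v := fine _ in vge *.
have v0 : 0 < v by apply: lt_le_trans vge; exact: expR_gt0.
have L0 : 0 < - ln r by rewrite oppr_gt0 ln_lt0// r0.
have -> : ln v / ln r = (- ln v) / (- ln r) by rewrite invrN mulrNN.
rewrite ler_pdivrMr//; apply: le_trans ka.
by rewrite lerNl -[leLHS]expRK ler_ln ?posrE ?expR_gt0.
Qed.

Lemma upper_local_dim_le_scales (K : nat) :
  (forall k r, (K <= k)%N -> C * expR (- (k%:R * B)) < r ->
     ((expR (- (k%:R * A)))%:E <= m (ball x r))%E) ->
  (upper_local_dim m x <= (A / B + eps)%:E)%E.
Proof.
move=> h.
have AB0 : 0 < A / B by rewrite divr_gt0.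
pose Z := Num.max 0 (ln C).
have Z0 : 0 <= Z by rewrite le_max lexx.
have ZC : ln C <= Z by rewrite le_max lexx orbT.
pose Y := 1 + K%:R * B + (A / B * Z + A) / eps.
apply: (@upper_local_dim_le _ (expR (- Y))); first exact: expR_gt0.
move=> r r0 rY.
have lY : Y < - ln r.
  by rewrite ltrNr -[ltRHS](expRK) ltr_ln ?posrE ?expR_gt0.
have e1 : 0 <= (A / B * Z + A) / eps.
  have ABZ : 0 <= A / B * Z by rewrite mulr_ge0// ltW.
  by apply: divr_ge0; [rewrite addr_ge0// ltW|rewrite ltW].
have KB : 0 <= K%:R * B by rewrite mulr_ge0// ltW.
set L := - ln r in lY.
have L0 : 0 < L by apply: lt_trans lY; rewrite /Y; lra.
have r1 : r < 1.
  by rewrite -[r]lnK ?posrE// -expR0 ltr_expR -oppr_gt0.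
have y0 : 0 <= L + Z by rewrite addr_ge0// ltW.
(* Rounded up this time, so that [C * expR (- (k * B)) < r]. *)
pose k := (Num.truncn ((L + Z) / B)).+1.
have /andP[k1 k2] := truncn_itv (divr_ge0 y0 (ltW B0)).
rewrite -/k in k2; rewrite ler_pdivlMr// in k1; rewrite ltr_pdivrMr// in k2.
have kE : k%:R = (Num.truncn ((L + Z) / B))%:R + 1 :> R by rewrite /k natr1.
have Kk : (K <= k)%N.
  apply: ltnW; rewrite ltnS truncn_ge_nat ?divr_ge0 ?(ltW B0)// ler_pdivlMr//.
  rewrite /Y in lY; lra.
apply: (@ratio_le k) => //.
  rewrite -lee_fin -mE; apply: h => //.
  rewrite -[C]lnK ?posrE// -expRD -[ltRHS]lnK ?posrE// ltr_expR; rewrite /L in k2; lra.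
have kA : k%:R * A <= (L + Z) * (A / B) + A.
  rewrite kE mulrDl mul1r lerD2r; set j := _%:R in k1 *.
  have -> : j * A = (j * B) * (A / B) by field; rewrite gt_eqF.
  by rewrite ler_wpM2r// ltW.
have eL : A / B * Z + A <= eps * L.
  rewrite [eps * L]mulrC -ler_pdivrMr//; apply: ltW; apply: le_lt_trans lY; rewrite /Y; lra.
rewrite -/L; lra.
Qed.

Lemma lower_local_dim_le_scales :
  (forall k0, exists2 k, (k0 <= k)%N & forall r, C * expR (- (k%:R * B)) < r ->
     ((expR (- (k%:R * A)))%:E <= m (ball x r))%E) ->
  (lower_local_dim m x <= (A / B + eps)%:E)%E.
Proof.
move=> h; apply: lower_local_dim_le => delta d0.
have AB0 : 0 < A / B by rewrite divr_gt0.
pose Z := Num.max 0 (ln (2 * C)).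
have Z0 : 0 <= Z by rewrite le_max lexx.
have ZC : ln (2 * C) <= Z by rewrite le_max lexx orbT.
pose W := Z + 1 + Num.max 0 (- ln delta) + A / B * Z / eps.
have [k Kk hk] := h (Num.truncn (W / B)).+1.
have D0 : 0 <= Num.max 0 (- ln delta) by rewrite le_max lexx.
have D1 : - ln delta <= Num.max 0 (- ln delta) by rewrite le_max lexx orbT.
have ABZ : 0 <= A / B * Z by rewrite mulr_ge0// ltW.
have e1 : 0 <= A / B * Z / eps by rewrite divr_ge0// ltW.
have kW : W < k%:R * B.
  rewrite -ltr_pdivrMr//; apply: lt_le_trans (truncnS_gt _) _; by rewrite ler_nat.
(* The factor 2 makes the required inequality on [r] strict. *)
pose r := 2 * (C * expR (- (k%:R * B))).
have r0 : 0 < r by rewrite /r !mulr_gt0// expR_gt0.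
have lr : ln r = ln (2 * C) - k%:R * B.
  by rewrite /r mulrA lnM ?posrE ?mulr_gt0 ?expR_gt0// expRK.
exists r; split=> //.
  rewrite -ltr_ln ?posrE// lr; rewrite /W in kW; lra.
apply: (@ratio_le k) => //.
- rewrite -[r]lnK ?posrE// -expR0 ltr_expR lr; rewrite /W in kW; lra.
- rewrite -lee_fin -mE; apply: hk; rewrite /r ltr_pMl ?mulr_gt0 ?expR_gt0//; lra.
rewrite lr.
have kA : k%:R * A = (k%:R * B) * (A / B) by field; rewrite gt_eqF.
have eW : A / B * Z <= eps * (k%:R * B - Z).
  rewrite mulrC -ler_pdivrMl// mulrC; rewrite /W in kW; lra.
rewrite kA; set a := A / B in AB0 eW *; set y := k%:R * B in eW *.
have : (a + eps) * (y - Z) <= (a + eps) * - (ln (2 * C) - y).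
  by rewrite ler_pM2l ?addr_gt0//; lra.
lra.
Qed.

End Mass_ge.
End LocalDimension.

(** * Paths *)

Section Paths.
Variable R : realType.
Variables (eps0 : R) (beta : R -> R).
Hypothesis eps0_gt0 : 0 < eps0.
Hypothesis beta_range : forall x, eps0 <= beta x <= 1 - eps0.
Hypothesis beta_nondecreasing : {homo beta : x y / x <= y}.
Variables (n : {measure set (R * R) -> \bar R}) (X : R -> R).
Hypothesis X_cadlag : cadlag X.
Hypothesis X_eq : solves_jump_equation beta n X.
Local Notation leb := (@lebesgue_measure R).

Let beta_gt0 x : 0 < beta x.
Proof. by case/andP: (beta_range x) => h _; exact: lt_le_trans h. Qed.

Definition jump_size (p : R * R) : R := p.2 `^ (beta (left_limit X p.1))^-1.

Let jump_size_ge0 p : (0 <= (jump_size p)%:E)%E.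
Proof. by rewrite lee_fin powR_ge0. Qed.

Lemma path_integral t : 0 <= t <= 1 ->
  (X t)%:E = (\int[n]_(p in `]0%R, t] `*` `]0%R, 1%R]) (jump_size p)%:E)%E.
Proof. by move=> t01; apply: X_eq; rewrite in_itv. Qed.

Lemma path_nondecreasing s t : 0 <= s -> s <= t -> t <= 1 -> X s <= X t.
Proof.
move=> s0 st t1; rewrite -lee_fin !path_integral ?s0 ?(le_trans s0 st)//=; last first.
  exact: le_trans t1.
apply: ge0_le_integral_subset => // p [/= + p2]; rewrite in_itv/= => /andP[p1 ps].
by split=> //; split=> //=; rewrite in_itv/= p1 (le_trans ps).
Qed.

Lemma left_limit_ge s u : 0 <= s -> s < u -> u <= 1 -> X s <= left_limit X u.
Proof.
move=> s0 su u1; have u0 : 0 < u by exact: le_lt_trans su.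
apply: limr_ge; first by apply: X_cadlag.2; rewrite in_itv/= u0.
near=> v; apply: path_nondecreasing => //.
  by near: v; exact: nbhs_left_ge.
by apply: le_trans u1; near: v; exact: nbhs_left_le.
Unshelve. all: end_near. Qed.

Lemma left_limit_le u y : 0 < u -> u <= 1 -> (forall s, 0 <= s -> s < u -> X s <= y) ->
  left_limit X u <= y.
Proof.
move=> u0 u1 h; apply: limr_le; first by apply: X_cadlag.2; rewrite in_itv/= u0.
near=> v; apply: h.
  by near: v; exact: nbhs_left_ge.
by near: v; exact: nbhs_left_lt.
Unshelve. all: end_near. Qed.

(** The left limit is monotone in time, so the exponent is a monotone function of time. *)
Lemma measurable_jump_size :
  measurable_fun (`]0, 1] `*` `]0, 1] : set (R * R)) (fun p => (jump_size p)%:E).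
Proof.
(* The left limit is extended monotonically to the whole line by freezing it outside the unit
   interval, where nothing is known of [X]. *)
pose L u := if u <= 0 then X 0 else if u <= 1 then left_limit X u else X 1.
have nL : {homo L : u v / u <= v}.
  move=> u v uv; rewrite /L; case: (leP u 0) => u0.
    case: (leP v 0) => v0 //; case: (leP v 1) => v1; first exact: left_limit_ge.
    exact: path_nondecreasing.
  have v0 : 0 < v by exact: lt_le_trans uv.
  have /negPf -> : ~~ (v <= 0) by rewrite -ltNge.
  case: (leP u 1) => u1; last first.
    by have /negPf -> : ~~ (v <= 1) by rewrite -ltNge (lt_le_trans u1).
  case: (leP v 1) => v1.
    apply: left_limit_le => // s s0 su; apply: left_limit_ge => //.
    exact: lt_le_trans uv.
  apply: left_limit_le => // s s0 su; apply: path_nondecreasing => //.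
  by apply: ltW; exact: lt_le_trans u1.
apply/measurable_EFinP.
apply: (@eq_measurable_fun _ _ _ _ _
    (fun p : R * R => expR ((beta (L p.1))^-1 * ln p.2))).
  move=> p; rewrite inE => -[/=]; rewrite !in_itv/= => /andP[p1 p11] /andP[p2 p21].
  by rewrite /jump_size /powR gt_eqF// /L leNgt p1/= p11.
apply: measurable_funTS; apply: measurableT_comp; first exact: measurable_expR.
apply: measurable_funM.
  apply: (@measurableT_comp _ _ _ _ _ _ (fun u => (beta (L u))^-1)) => //.
  apply: nonincreasing_measurable => // u v uv.
  by rewrite lef_pV2 ?posrE// beta_nondecreasing// nL.
by apply: measurableT_comp => //; exact: measurable_ln.
Qed.

Let measurable_jump_sizeS (A : set (R * R)) : A `<=` `]0, 1] `*` `]0, 1] ->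
  measurable_fun A (fun p => (jump_size p)%:E).
Proof. by move=> h; apply: measurable_funS measurable_jump_size => //; exact: measurable_setX. Qed.

Lemma path_increment s t : 0 <= s -> s <= t -> t <= 1 ->
  (X t - X s)%:E = (\int[n]_(p in `]s, t] `*` `]0%R, 1%R]) (jump_size p)%:E)%E.
Proof.
move=> s0 st t1.
have U : (`]0, t] `*` `]0, 1] : set (R * R)) = (`]0, s] `*` `]0, 1]) `|` (`]s, t] `*` `]0, 1]).
  apply/seteqP; split => p.
    move=> [/= + p2]; rewrite in_itv/= => /andP[p1 pt].
    by case: (leP p.1 s) => ps; [left|right]; split=> //=; rewrite in_itv/= ?p1 ?ps.
  case=> -[/= + p2]; rewrite in_itv/= => /andP[p1 pt]; split => //=; rewrite in_itv/=.
    by rewrite p1 (le_trans pt).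
  by rewrite pt (le_lt_trans s0).
rewrite EFinB (path_integral (t := t)) ?(le_trans s0 st)//.
have mU : measurable_fun ((`]0, s] `*` `]0, 1]) `|` (`]s, t] `*` `]0, 1]) : set (R * R))
    (fun p => (jump_size p)%:E).
  apply: measurable_jump_sizeS; rewrite -U => p [/= + p2]; rewrite in_itv/= => /andP[p1 pt].
  by split=> //=; rewrite in_itv/= p1 (le_trans pt).
rewrite U (ge0_integral_setU n (measurable_setX _ _) (measurable_setX _ _) mU)//.
  by rewrite -path_integral ?s0 ?(le_trans st)// addeAC subee// add0e.
apply/disj_setPS => p [[/= + _] [/= + _]]; rewrite !in_itv/= => /andP[_ h] /andP[h' _].
by move: h'; rewrite ltNge h.
Qed.

Lemma path_increment_ge s t (A : set (R * R)) c : 0 <= s -> s <= t -> t <= 1 -> 0 <= c ->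
  measurable A -> A `<=` `]s, t] `*` `]0, 1] -> (1 <= n A)%E ->
  (forall p, A p -> c <= jump_size p) -> c <= X t - X s.
Proof.
move=> s0 st t1 c0 mA sA nA cA; rewrite -lee_fin path_increment//.
apply: (@le_trans _ _ (\int[n]_(p in A) c%:E)%E).
  by rewrite integral_cst// -[leLHS]mule1 lee_wpmul2l// lee_fin.
apply: ge0_le_integral_subset => // p Ap; split; first exact: sA.
by rewrite lee_fin cA.
Qed.


Local Notation dy k := (2^-1 ^+ k : R).

(* The dyadic blocks below the threshold contribute a geometric series of
   ratio [2 * 2^(-1/al)], which is less than 1 because [al < 1]. *)
Lemma path_increment_le s t al e k (m : nat) : 0 <= s -> s <= t -> t <= 1 ->
  beta (X t) <= al -> al < 1 ->
  (n (`]s, t] `*` large e k) <= 0)%E ->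
  (forall j, (n (`]s, t] `*` block e k j) <= (m * 2 ^ j)%N%:R%:E)%E) ->
  X t - X s <= m%:R / (1 - 2 * 2^-1 `^ al^-1) * (dy k ^+ e) `^ al^-1.
Proof.
move=> s0 st t1 bal al1 nlarge nblock.
have al0 : 0 < al by exact: lt_le_trans bal.
set c := dy k ^+ e; have c0 : 0 < c by rewrite exprn_gt0// dy_gt0.
pose Bl : set (R * R) := `]s, t] `*` large e k.
(* Half-open blocks, so that they are disjoint and the integral splits over them. *)
pose B j : set (R * R) := `]s, t] `*` `[c * dy j.+1, c * dy j[.
have mB j : measurable (B j) by apply: measurable_setX; exact: measurable_itv.
have mBl : measurable Bl by apply: measurable_setX; exact: measurable_itv.
have dom (A : set (R * R)) : A `<=` `]s, t] `*` `]0, 1] -> A `<=` `]0, 1] `*` `]0, 1].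
  move=> h p /h [/= + p2]; rewrite in_itv/= => /andP[p1 pt]; split=> //=.
  by rewrite in_itv/= (le_lt_trans s0 p1) (le_trans pt).
have c1 : c <= 1 by rewrite exprn_ile1// dy_le1.
have domB j : B j `<=` `]s, t] `*` `]0, 1].
  move=> p [p1 /=]; rewrite in_itv/= => /andP[p2 p3]; split=> //=; rewrite in_itv/=.
  have d1 := dy_le1 R j; have d0 := dy_gt0 R j; have d2 := dy_gt0 R j.+1.
  apply/andP; split; first by apply: lt_le_trans p2; rewrite mulr_gt0.
  by apply: ltW; apply: (lt_le_trans p3); rewrite mulr_ile1// ltW.
have domBl : Bl `<=` `]s, t] `*` `]0, 1].
  move=> p [p1]; rewrite /large/= !in_itv/= => /andP[p2 p3]; split=> //=.
  by rewrite p3 (lt_le_trans c0).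
have ia1 : 1 < al^-1 by rewrite -[ltLHS]invr1 ltf_pV2 ?posrE.
(* Before time [t] the index of the path is at most [beta (X t) <= al], and a mark [z <= 1] gives a
   larger power when the index grows. *)
have jle p y : (`]s, t] `*` `]0, 1]) p -> p.2 <= y -> jump_size p <= y `^ al^-1.
  move=> [/=]; rewrite !in_itv/= => /andP[p1 pt] /andP[p20 p21] py.
  apply: (@le_trans _ _ (p.2 `^ al^-1)).
    apply: ger_powR; first by rewrite p20.
    rewrite lef_pV2 ?posrE//; apply: le_trans bal; apply: beta_nondecreasing.
    apply: left_limit_le; rewrite ?(le_lt_trans s0 p1) ?(le_trans pt)// => v v0 vp.
    by apply: path_nondecreasing => //; exact: le_trans (ltW vp) pt.
  apply: ge0_ler_powR => //; rewrite ?nnegrE ?invr_ge0 ltW//.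
  by apply: lt_le_trans py.
set K := 2 * 2^-1 `^ al^-1.
have K0 : 0 < K by rewrite mulr_gt0// powR_gt0.
have K1 : K < 1.
  suff : 2^-1 `^ al^-1 < 2^-1 :> R by rewrite /K; lra.
  rewrite /powR invr_eq0 pnatr_eq0/= -[ltRHS]lnK ?posrE ?invr_gt0//.
  have : ln 2^-1 < 0 :> R by apply: ln_lt0; lra.
  by rewrite ltr_expR; nra.
have cov : (`]s, t] `*` `]0, 1] : set (R * R)) = Bl `|` \bigcup_j B j.
  apply/seteqP; split => p; last by case=> [/domBl//|[j _ /domB]].
  move=> [p1 /=]; rewrite in_itv/= => /andP[p2 p3].
  case: (leP c p.2) => pc; [left; split=> //=; by rewrite /large/= in_itv/= pc|right].
  have ex : exists j, c * dy j.+1 <= p.2.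
    have [j hj] := dy_lt p2; exists j; apply: le_trans (ltW hj).
    rewrite -[leRHS]mul1r ler_pM ?dy_anti// ltW//; exact: dy_gt0.
  case: (ex_minnP ex) => j hj jmin; exists j => //; split=> //=; rewrite in_itv/= hj/=.
  case: j hj jmin => [|j] hj jmin; first by rewrite expr0 mulr1.
  by rewrite ltNge; apply/negP => /jmin; rewrite ltnn.
have tB : trivIset setT B.
  have lt_disj i j p : (i < j)%N -> B i p -> B j p -> False.
    move=> ij [_ /=]; rewrite in_itv/= => /andP[p2 _] [_ /=].
    rewrite in_itv/= => /andP[_ p3].
    have := lt_le_trans p3 (ler_wpM2l (ltW c0) (dy_anti _ ij)).
    by rewrite ltNge p2.
  move=> i j _ _ [p [Bi Bj]]; have [ij|ij|//] := ltngtP i j.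
    by case: (lt_disj _ _ _ ij Bi Bj).
  by case: (lt_disj _ _ _ ij Bj Bi).
have mf (A : set (R * R)) : A `<=` `]s, t] `*` `]0, 1] ->
    measurable_fun A (fun p => (jump_size p)%:E).
  by move=> h; apply: measurable_jump_sizeS; exact: dom.
have mBs : measurable (\bigcup_j B j) by exact: bigcup_measurable.
have domBs : \bigcup_j B j `<=` `]s, t] `*` `]0, 1] by move=> p [j _ /domB].
rewrite -lee_fin path_increment// cov ge0_integral_setU//=; last 2 first.
- by rewrite -cov; exact: mf.
- apply/disj_setPS => p [[_]]; rewrite /large/= in_itv/= => /andP[cp _] [j _ [_ /=]].
  rewrite in_itv/= => /andP[_ h]; move: cp; rewrite leNgt.
  by rewrite (lt_le_trans h)// ger_pMr// dy_le1.
have -> : (\int[n]_(p in Bl) (jump_size p)%:E = 0)%E.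
  apply: le_anti; rewrite integral_ge0 ?andbT//.
  apply: (@le_trans _ _ (\int[n]_(p in Bl) 1%:E)%E).
    apply: ge0_le_integral_subset => // p Bp; split => //.
    rewrite lee_fin; apply: (@le_trans _ _ (1 `^ al^-1)); last by rewrite powR1.
    apply: jle; first exact: domBl.
    by case: Bp => _; rewrite /large/= in_itv/= => /andP[].
  by rewrite integral_cst// mul1e.
rewrite add0e ge0_integral_bigcup//; last exact: mf.
pose w := c `^ al^-1.
apply: (@le_trans _ _ (\sum_(j <oo) (geometric (m%:R * w) K j)%:E)%E).
  apply: lee_nneseries => [j _ _|j _]; first exact: integral_ge0.
  apply: (@le_trans _ _ (\int[n]_(p in B j) (w * (dy j) `^ al^-1)%:E)%E).
    apply: ge0_le_integral_subset => // [p _|p Bp].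
      by rewrite lee_fin mulr_ge0// powR_ge0.
    split=> //; rewrite lee_fin /w -(powRM _ (ltW c0) (ltW (dy_gt0 R j))).
    apply: jle; first exact: domB Bp.
    by case: Bp => _; rewrite /= in_itv/= => /andP[_ /ltW].
  rewrite integral_cst//.
  have nB : (n (B j) <= (m * 2 ^ j)%N%:R%:E)%E.
    apply: le_trans (nblock j); apply: le_measure; rewrite ?inE//.
      by apply: measurable_setX; exact: measurable_itv.
    move=> p [p1 /=]; rewrite in_itv/= => /andP[p2 /ltW p3]; split=> //=.
    rewrite /block/= in_itv/= p2/= (le_trans p3)// exprS -/c.
    by rewrite le_eqVlt; apply/orP; left; apply/eqP; set u := dy j; field.
  apply: (@le_trans _ _ ((w * (dy j) `^ al^-1)%:E * (m * 2 ^ j)%N%:R%:E)%E).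
    by rewrite lee_wpmul2l// lee_fin mulr_ge0// powR_ge0.
  rewrite -EFinM lee_fin /= /K exprMn natrM natrX.
  have -> : dy j `^ al^-1 = (2^-1 `^ al^-1) ^+ j.
    by rewrite -(powR_mulrn j (_ : 0 <= 2^-1))// -(powR_mulrn j (powR_ge0 _ _)) powRAC.
  rewrite le_eqVlt; apply/orP; left; apply/eqP; ring.
have : (series (geometric (m%:R * w) K) @ \oo --> (m%:R * w) * (1 - K)^-1)%R.
  by apply: cvg_geometric_series; rewrite ger0_norm// ltW.
move=> h; rewrite le_eqVlt; apply/orP; left; apply/eqP; apply/cvg_lim => //.
under eq_fun do rewrite sumEFin.
apply: cvg_EFin; first by apply: nearW => ?; rewrite fin_numE.
rewrite /comp/= mulrAC; exact: h.
Qed.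

(** Without a mark at [t], monotone convergence makes [X t] the limit of the values of [X] at times
    strictly before [t]. *)
Lemma left_limit_no_jump t : 0 < t -> t <= 1 ->
  (n ([set t] `*` `]0%R, 1%R]) <= 0)%E -> left_limit X t = X t.
Proof.
move=> t0 t1 nt; apply/eqP; rewrite eq_le; apply/andP; split.
  by apply: left_limit_le => // s s0 st; apply: path_nondecreasing => //; exact: ltW.
pose F m : set (R * R) := `]0, t - t / m.+1%:R] `*` `]0, 1].
pose S : set (R * R) := [set t] `*` `]0, 1].
have mF m : measurable (F m) by apply: measurable_setX; exact: measurable_itv.
have mS : measurable S by apply: measurable_setX; [exact: measurable_set1|exact: measurable_itv].
have tm m : 0 <= t - t / m.+1%:R < t.
  have h : 0 < t / m.+1%:R by rewrite divr_gt0.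
  have h2 : t / m.+1%:R <= t by rewrite ler_pdivrMr// ler_peMr ?(ltW t0)// ler1n.
  by rewrite subr_ge0 h2 ltrBlDr ltrDl.
have domF m : F m `<=` `]0, 1] `*` `]0, 1].
  move=> p [/= + p2]; rewrite in_itv/= => /andP[p1 pt]; split=> //=.
  have /andP[_ /ltW h] := tm m.
  by rewrite in_itv/= p1 (le_trans pt)// (le_trans h).
have domS : S `<=` `]0, 1] `*` `]0, 1].
  by move=> p [/= -> p2]; split=> //=; rewrite in_itv/= t0.
have cov : (`]0, t] `*` `]0, 1] : set (R * R)) = S `|` \bigcup_m F m.
  apply/seteqP; split => p.
    move=> [/= + p2]; rewrite in_itv/= le_eqVlt => /andP[p1 /predU1P[pt|pt]].
      by left.
    right; exists (Num.truncn (t / (t - p.1))) => //; split=> //=; rewrite in_itv/= p1/=.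
    rewrite lerBrDr -lerBrDl ler_pdivrMr// mulrC -ler_pdivrMr ?subr_gt0//.
    exact: ltW (truncnS_gt _).
  case=> [[/= -> p2]|[m _ [/= + p2]]]; first by split=> //=; rewrite in_itv/= t0 lexx.
  rewrite in_itv/= => /andP[p1 pt]; split=> //=; rewrite in_itv/= p1 (le_trans pt)//.
  by have /andP[_ /ltW] := tm m.
have mU : measurable_fun (S `|` \bigcup_m F m) (fun p => (jump_size p)%:E).
  by apply: measurable_jump_sizeS => p [/domS|[m _ /domF]].
rewrite -lee_fin path_integral; last by rewrite ltW.
rewrite cov ge0_integral_setU//=; last 2 first.
- exact: bigcup_measurable.
- apply/disj_setPS => p [[/= pt _] [m _ [/= + _]]]; rewrite pt in_itv/= => /andP[_].
  by have /andP[_] := tm m; rewrite leNgt => ->.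
have -> : (\int[n]_(p in S) (jump_size p)%:E = 0)%E.
  apply: le_anti; rewrite integral_ge0 ?andbT//.
  apply: (@le_trans _ _ (\int[n]_(p in S) 1%:E)%E); last by rewrite integral_cst// mul1e.
  apply: ge0_le_integral_subset => // p Sp; split=> //.
  case: Sp => _ /=; rewrite in_itv/= => /andP[p2 p3].
  rewrite lee_fin /jump_size.
  apply: (@le_trans _ _ (1 `^ (beta (left_limit X p.1))^-1)); last by rewrite powR1.
  apply: ge0_ler_powR => //; rewrite ?nnegrE ?(ltW p2)// invr_ge0 ltW//.
rewrite add0e.
have ndF : nondecreasing_seq F.
  apply/nondecreasing_seqP => m; rewrite subsetEset => p [/= + p2].
  rewrite in_itv/= => /andP[p1 pt]; split=> //=; rewrite in_itv/= p1/= (le_trans pt)//.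
  by rewrite lerB// ler_pM2l// lef_pV2 ?posrE// ler_nat.
have := ge0_nondecreasing_set_cvg_integral ndF mF
  (fun m => measurable_jump_sizeS (domF m)) (fun m x _ => jump_size_ge0 x) (mu := n).
move=> /cvg_lim <- //; apply: lime_le.
  apply: ereal_nondecreasing_is_cvgn; apply: ge0_nondecreasing_set_nondecreasing_integral => //.
  by move=> m; exact: measurable_jump_sizeS.
apply: nearW => m; have /andP[h1 h2] := tm m.
rewrite -path_integral; first by rewrite lee_fin left_limit_ge.
by rewrite h1 (le_trans (ltW h2)).
Qed.

(** * Occupation measure of balls and location of the support *)

Local Notation mu := (occupation_measure X).

Lemma in_ballP (x r y : R) : ball x r y <-> x - r < y < x + r.
Proof.
by rewrite -ball_normE /ball_/= ltr_distlC; split.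
Qed.

Lemma occupation_measure_ge a b x r : 0 <= a -> a <= b -> b <= 1 ->
  (forall s, a < s -> s < b -> ball x r (X s)) -> ((b - a)%:E <= mu (ball x r))%E.
Proof.
move=> a0 ab b1 h.
apply: (@le_trans _ _ (\int[leb]_(s in `]a, b[) 1%:E)%E).
  have -> : (\int[leb]_(s in `]a, b[) 1%:E = leb `]a, b[%classic)%E.
    by rewrite integral_cst ?mul1e//; exact: measurable_itv.
  rewrite lebesgue_measure_itv/= lte_fin.
  by case: ltP => // ba; rewrite lee_fin subr_le0.
apply: ge0_le_integral_subset => // s; rewrite /= !in_itv/= => /andP[s1 s2].
split; first by rewrite (le_trans a0 (ltW s1)) (le_trans (ltW s2)).
by rewrite indicE mem_set//; exact: h.
Qed.

Lemma occupation_measure_le a b x r : a <= b ->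
  (forall s, 0 <= s -> s <= 1 -> ball x r (X s) -> a <= s <= b) ->
  (mu (ball x r) <= (b - a)%:E)%E.
Proof.
move=> ab h.
apply: (@le_trans _ _ (\int[leb]_(s in `[0%R, 1%R]) (\1_(`[a, b]%classic : set R) s)%:E)%E).
  apply: ge0_le_integral_subset => // s; rewrite /= in_itv/= => /andP[s0 s1]; split.
    by rewrite ?in_itv/= ?s0 ?s1.
  rewrite lee_fin !indicE; have [bs|nbs] := pselect (ball x r (X s)).
    by rewrite !mem_set//= in_itv/=; exact: h.
  by rewrite (memNset nbs).
rewrite integral_indic//; [|exact: measurable_itv..].
apply: (@le_trans _ _ (leb `[a, b]%classic)).
  by apply: le_measure; rewrite ?inE//; apply: measurableI; exact: measurable_itv.
rewrite lebesgue_measure_itv/= lte_fin; case: ifPn => // _.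
by rewrite lee_fin subr_ge0.
Qed.

Lemma occupation_measure_ball_fin x r : mu (ball x r) \is a fin_num.
Proof.
rewrite ge0_fin_numE ?integral_ge0//; apply: (@le_lt_trans _ _ (1 - 0)%:E); last exact: ltry.
by apply: occupation_measure_le => // s -> ->.
Qed.

(** The visit can be taken before time 1 because a single instant has length 0. *)
Lemma msupport_visited x r : msupport mu x -> 0 < r ->
  exists s, [/\ 0 <= s, s < 1 & ball x r (X s)].
Proof.
move=> sx r0; apply: contrapT => h; have := sx r r0; rewrite ltNge => /negP; apply.
have -> : 0%E = (1 - 1)%:E :> \bar R by rewrite subrr.
apply: occupation_measure_le => // s s0 s1 bs; rewrite s1 andbT leNgt; apply/negP => ls1.
by apply: h; exists s.
Qed.

(** Let [t] be the supremum of the times at which the path is at most [x]. Then [x] lies between the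
    left limit and the value at [t]; strictly between them, a small ball around [x] would never be
    visited. *)
Lemma msupport_location x : msupport mu x ->
  exists2 t, 0 <= t <= 1 & (t < 1 /\ x = X t) \/ (0 < t /\ x = left_limit X t).
Proof.
move=> sx.
pose S := [set s | 0 <= s <= 1 /\ X s <= x].
have x0 : X 0 <= x.
  rewrite leNgt; apply/negP => xX.
  have [|s [s0 s1 /in_ballP/andP[_]]] := msupport_visited sx (r := X 0 - x); first lra.
  have := path_nondecreasing (lexx 0) s0 (ltW s1); lra.
have S0 : S 0 by split=> //; rewrite lexx ler01.
have Sub : has_sup S by split; [exists 0|exists 1 => s [/andP[]]].
pose t := sup S.
have t0 : 0 <= t by apply: ub_le_sup => //; case: Sub.
have t1 : t <= 1 by apply: ge_sup; [exists 0|move=> s [/andP[]]].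
have below s : 0 <= s -> s < t -> X s <= x.
  move=> s0 st; have ts : 0 < t - s by rewrite subr_gt0.
  have [s' [/andP[s'0 s'1] xs'] ss'] := sup_adherent ts Sub.
  apply: le_trans xs'; apply: path_nondecreasing => //; apply: ltW.
  by move: ss'; rewrite opprB addrC subrK.
have above s : t < s -> s <= 1 -> x < X s.
  move=> ts s1; rewrite ltNge; apply/negP => Xs.
  have : s <= t by apply: ub_le_sup; [case: Sub|split=> //; rewrite s1 (le_trans t0 (ltW ts))].
  by rewrite leNgt ts.
exists t; first by rewrite t0.
have leftle : 0 < t -> left_limit X t <= x by move=> tp; exact: left_limit_le.
have stuck : 0 < t -> left_limit X t < x -> (t < 1 -> x < X t) -> False.
  move=> tp Lx xX.
  (* For [t = 1] only the gap on the left counts, as visits occur before time 1. *)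
  pose r := if t < 1 then Num.min (x - left_limit X t) (X t - x) else x - left_limit X t.
  have r0 : 0 < r.
    rewrite /r; case: ifPn => [t1'|_]; last by rewrite subr_gt0.
    by rewrite lt_min !subr_gt0 Lx xX.
  have [s [s0 s1 /in_ballP/andP[h1 h2]]] := msupport_visited sx r0.
  have rL : r <= x - left_limit X t by rewrite /r; case: ifPn => // _; rewrite ge_min lexx.
  case: (ltP s t) => st; first by have := left_limit_ge s0 st t1; lra.
  have tl1 : t < 1 by exact: le_lt_trans s1.
  have rX : r <= X t - x by rewrite /r tl1 ge_min lexx orbT.
  have := path_nondecreasing t0 st (ltW s1); lra.
have [tl1|tg1] := ltP t 1.
  have xXt : x <= X t.
    have c : X s @[s --> t^'+] --> X t by apply: X_cadlag.1; rewrite in_itv/= t0.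
    rewrite -(cvg_lim _ c)//; apply: limr_ge; first exact: cvgP c.
    near=> s; apply: ltW; apply: above; near: s.
      exact: nbhs_right_gt.
    exact: nbhs_right_le.
  have [->|xX] := eqVneq x (X t); first by left.
  have {xX}xXt : x < X t by rewrite lt_neqAle xX.
  right; have tp : 0 < t.
    rewrite lt_neqAle t0 andbT; apply/eqP => t00; move: xXt; rewrite -t00; lra.
  split=> //; apply/eqP; rewrite eq_le (leftle tp) andbT leNgt; apply/negP => Lx.
  exact: (stuck tp Lx).
right; have tp : 0 < t by exact: lt_le_trans tg1.
split=> //; apply/eqP; rewrite eq_le (leftle tp) andbT leNgt; apply/negP => Lx.
by apply: (stuck tp Lx); rewrite ltNge tg1.
Unshelve. all: end_near. Qed.

(** Two visits to the ball more than two cell lengths apart would enclose a whole cell, whose jump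
    alone is at least the diameter [2 * r]. So all visits lie within two cell lengths of any one of
    them. *)
Lemma occupation_measure_ball_le x al delta q k r : 0 < al -> r <= delta ->
  al <= beta (x - delta) -> (0 < k)%N ->
  (forall i, (i < cells q k)%N ->
    (1 <= n (`](i%:R * dy k ^+ q)%R, (i.+1%:R * dy k ^+ q)%R] `*`
             `[(dy k ^+ q.+1)%R, (2 * dy k ^+ q.+1)%R]))%E) ->
  2 * r <= (dy k ^+ q.+1) `^ al^-1 ->
  (mu (ball x r) <= (4 * dy k ^+ q)%:E)%E.
Proof.
move=> al0 rdelta albeta k0 hit hr.
set h := dy k ^+ q; have h0 : 0 < h by rewrite exprn_gt0// dy_gt0.
set c := dy k ^+ q.+1 in hit hr; have c0 : 0 < c by rewrite exprn_gt0// dy_gt0.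
have c1 : 2 * c <= 1.
  have d1 : dy k <= 2^-1 by have := dy_anti R k0; rewrite expr1.
  have : c <= dy k by rewrite /c exprS ger_pMr ?dy_gt0// exprn_ile1// dy_le1.
  lra.
have diam s s' : 0 <= s -> s' <= 1 -> ball x r (X s) -> ball x r (X s') -> s' <= s + 2 * h.
  move=> s0 s'1 /in_ballP/andP[b1 b2] /in_ballP/andP[b3 b4].
  rewrite leNgt; apply/negP => ss'.
  have [j [j1 j2 _]] := locate_cell q k s0; rewrite -/h in j1 j2.
  have jr : (j.+2)%:R * h <= s + 2 * h.
    by rewrite -addn2 natrD mulrDl lerD2r.
  (* The cell of [s] may start before [s], so the next one is used; it ends by [s + 2 * h < s']. *)
  have jc : (j.+1 < cells q k)%N.
    rewrite -(ltr_nat R) cells_dy -/h -[ltRHS]mul1r ltr_pdivlMr//.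
    have : j.+1%:R * h <= j.+2%:R * h by rewrite ler_pM2r// ler_nat.
    lra.
  pose A : set (R * R) := `](j.+1%:R * h)%R, (j.+2%:R * h)%R] `*` `[c, (2 * c)%R].
  have mA : measurable A by apply: measurable_setX; exact: measurable_itv.
  have sA : A `<=` `]s, s'] `*` `]0, 1].
    move=> p [/=]; rewrite !in_itv/= => /andP[p1 p2] /andP[p3 p4].
    split=> /=; rewrite ?in_itv/=; first by rewrite (lt_trans j2)//= ltW//; lra.
    by rewrite (lt_le_trans c0)// (le_trans p4).
  suff : c `^ al^-1 <= X s' - X s by lra.
  apply: (path_increment_ge s0 _ s'1 _ mA sA (hit _ jc)) => [||p Ap].
  - by apply: ltW; apply: le_lt_trans ss'; rewrite lerDl mulr_ge0// ltW.
  - exact: powR_ge0.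
  have [] := sA p Ap; rewrite /= !in_itv/= => /andP[p1 p2] /andP[p3 p4].
  have cp : c <= p.2 by case: Ap => _ /=; rewrite in_itv/= => /andP[].
  apply: (@le_trans _ _ (p.2 `^ al^-1)).
    apply: ge0_ler_powR => //; rewrite ?nnegrE ?invr_ge0; exact: ltW.
  apply: ger_powR; first by rewrite p3.
  rewrite lef_pV2 ?posrE//; apply: le_trans albeta _; apply: beta_nondecreasing.
  have := left_limit_ge s0 p1 (le_trans p2 s'1); lra.
have [[s0 [s00 s01 bs0]]|none] := pselect (exists s, [/\ 0 <= s, s <= 1 & ball x r (X s)]).
  have -> : 4 * h = (s0 + 2 * h) - (s0 - 2 * h) by ring.
  apply: occupation_measure_le => [|s s0' s1 bs]; first lra.
  have := diam _ _ s00 s1 bs0 bs; have := diam _ _ s0' s01 bs bs0 => a1 a2.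
  apply/andP; split; lra.
apply: (@le_trans _ _ (0 - 0)%:E); last by rewrite lee_fin subrr mulr_ge0// ltW.
by apply: occupation_measure_le => // s s0 s1 bs; case: none; exists s.
Qed.

Definition increment_cst (m : nat) al : R := m%:R / (1 - 2 * 2^-1 `^ al^-1).

(** On a side free of large jumps the path stays within [r] of [x] for a time [dy k ^+ q]. On the
    right the index is controlled at the far end [X (t + dy k ^+ q)]; on the left [beta x] bounds it
    by monotonicity. *)
Lemma occupation_measure_ball_ge x t q e k (m : nat) al r : 0 <= t -> t <= 1 -> al < 1 ->
  (forall i j, (i <= cells q k)%N ->
    (n (window q k i `*` block e k j) <= (m * 2 ^ j)%N%:R%:E)%E) ->
  [/\ x = X t, t + dy k ^+ q <= 1, beta (X (t + dy k ^+ q)) <= al &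
     (n (`]t, (t + dy k ^+ q)%R] `*` large e k) <= 0)%E] \/
  [/\ x = left_limit X t, 0 < t, 0 <= t - dy k ^+ q, beta x <= al &
     (n (`[(t - dy k ^+ q)%R, t[ `*` large e k) <= 0)%E] ->
  increment_cst m al * (dy k ^+ e) `^ al^-1 < r ->
  ((dy k ^+ q)%:E <= mu (ball x r))%E.
Proof.
move=> t0 t1 al1 counts side hr.
set h := dy k ^+ q in side *; have h0 : 0 < h by rewrite exprn_gt0// dy_gt0.
have [i [i1 i2 ic]] := locate_cell q k t0; have {}ic := ic t1; rewrite -/h in i1 i2.
rewrite -[i.+1%:R]natr1 in i2.
have near_window s s' j : t - h <= s -> s' <= t + h ->
    (n (`]s, s'] `*` block e k j) <= (m * 2 ^ j)%N%:R%:E)%E.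
  move=> ts st; apply: le_trans (counts i j ic); apply: le_measure; rewrite ?inE.
  - by apply: measurable_setX; [exact: measurable_itv|].
  - exact: measurable_setX.
  move=> p [/= + p2]; rewrite in_itv/= => /andP[p1 p3]; split=> //=.
  rewrite /window/= in_itv/= -/h; apply/andP; split; nra.
case: side => [[-> th1 bal nl]|[-> tp th1 bal nl]].
  have -> : h = t + h - t by ring.
  apply: occupation_measure_ge => // [|s s1 s2]; first by rewrite lerDl ltW.
  apply/in_ballP; have st0 := le_trans t0 (ltW s1).
  have a1 := path_nondecreasing t0 (ltW s1) (le_trans (ltW s2) th1).
  have a2 := path_nondecreasing st0 (ltW s2) th1.
  have tth : t <= t + h by rewrite lerDl ltW.
  have := path_increment_le t0 tth th1 bal al1 nl.
  move=> /(_ m); rewrite -/(increment_cst m al) => a3.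
  have {}a3 := le_lt_trans (a3 (fun j => near_window _ _ j _ (lexx _))) hr.
  have {}a3 : X (t + h) - X t < r by apply: a3; rewrite lerBlDr lerDl ltW.
  apply/andP; split; lra.
have -> : h = t - (t - h) by ring.
apply: occupation_measure_ge => // [|s s1 s2]; first by rewrite gerBl ltW.
apply/in_ballP; have s0 : 0 <= s by exact: le_trans (ltW s1).
have a1 := left_limit_ge s0 s2 t1.
suff a2 : left_limit X t <= X s + increment_cst m al * (dy k ^+ e) `^ al^-1.
  apply/andP; split; lra.
apply: left_limit_le => // v v0 vt.
(* The increment bound is applied up to a time before [t], so that a jump at [t] does not enter. *)
apply: (@le_trans _ _ (X (Num.max s v))).
  by apply: path_nondecreasing; rewrite ?le_max ?lexx ?orbT// ge_max !ltW//; exact: lt_le_trans t1.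
have sm : s <= Num.max s v by rewrite le_max lexx.
have mt : Num.max s v < t by rewrite gt_max s2.
have m0 := le_trans s0 sm.
rewrite -lerBlDl; apply: path_increment_le => //; first exact: le_trans (ltW mt) t1.
- by apply: le_trans bal; apply: beta_nondecreasing; exact: left_limit_ge.
- apply: le_trans nl; apply: le_measure; rewrite ?inE.
  + by apply: measurable_setX; [exact: measurable_itv|].
  + by apply: measurable_setX; [exact: measurable_itv|].
  move=> p [/= + p2]; rewrite in_itv/= => /andP[p1 p3]; split=> //=.
  by rewrite ?in_itv/= (le_lt_trans p3)// andbT ltW// (lt_trans s1).
- by move=> j; apply: near_window; [exact: ltW|rewrite (le_trans (ltW mt))// lerDl ltW].
Qed.

(** * Sides free of large jumps, for a realization obeying the almost sure bounds *)

Hypothesis beta_lipschitz : exists k : R, k.-lipschitz beta.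
Hypothesis n_integer : forall A, measurable A ->
  n A = +oo%E \/ exists j : nat, n A = (j%:R)%:E.
Hypothesis n_cells : forall q, exists K, forall k, (K <= k)%N ->
  forall i, (i < cells q k)%N ->
    (1 <= n (`](i%:R * dy k ^+ q)%R, (i.+1%:R * dy k ^+ q)%R] `*`
             `[(dy k ^+ q.+1)%R, (2 * dy k ^+ q.+1)%R]))%E.
Hypothesis n_blocks : forall q e, (e < q)%N -> exists K, forall k, (K <= k)%N ->
  forall i j, (i <= cells q k)%N ->
    (n (window q k i `*` block e k j) <= ((q + 24) * 2 ^ j)%N%:R%:E)%E.
Hypothesis n_windows : forall p, exists K, forall k, (K <= k)%N ->
  forall i, (i <= cells p.+1.*2 k)%N -> (n (window p.+1.*2 k i `*` large p k) <= 1)%E.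
Hypothesis n_ends : forall q e, (e < q)%N -> exists K, forall k, (K <= k)%N ->
  (n (`[0%R, (dy k ^+ q)%R] `*` large e k) <= 0)%E /\
  (n (`[(1 - dy k ^+ q)%R, 1%R] `*` large e k) <= 0)%E.
Hypothesis n_punctured : forall e t, 0 <= t <= 1 -> forall k0, exists2 k, (k0 <= k)%N &
  (n (punctured t (dy k ^+ e.+1) `*` large e k) <= 0)%E.

Lemma beta_continuous x eta : 0 < eta ->
  exists2 delta, 0 < delta & forall y, `|y - x| <= delta -> `|beta y - beta x| <= eta.
Proof.
move=> eta0; have [k lk] := beta_lipschitz.
(* The given Lipschitz constant need not be positive. *)
pose K := Num.max 1 k; have K0 : 0 < K by rewrite lt_max ltr01.
exists (eta / K); first by rewrite divr_gt0.
move=> y yx; have := lk (y, x) (conj I I) => /= h; apply: le_trans h _.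
apply: (@le_trans _ _ (K * `|y - x|)).
  by rewrite ler_wpM2r// le_max lexx orbT.
by rewrite mulrC -ler_pdivlMr.
Qed.

Lemma n_lt1 (A : set (R * R)) : measurable A -> ~ (1 <= n A)%E -> (n A <= 0)%E.
Proof.
move=> mA; case: (n_integer mA) => [->|[[|j] ->]]; first by rewrite leey.
  by rewrite lexx.
by move=> []; rewrite lee_fin ler1n.
Qed.

Lemma n_disjoint (A B C : set (R * R)) : measurable A -> measurable B -> measurable C ->
  A `&` B = set0 -> A `|` B `<=` C -> (n C <= 1)%E -> (1 <= n A)%E -> (n B <= 0)%E.
Proof.
move=> mA mB mC AB ABC nC nA; apply: n_lt1 => // nB.
have : (n (A `|` B) <= 1)%E.
  by apply: le_trans nC; apply: le_measure; rewrite ?inE//; exact: measurableU.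
rewrite measureU//; apply/negP; rewrite -ltNge.
apply: (@lt_le_trans _ _ (1 + 1)%E); last exact: leeD.
by rewrite -EFinD lte_fin ltrDl.
Qed.

(** The side has to be the one on which [x] is the one-sided limit of the path at [t]. *)
Definition side (x t al : R) (q e k : nat) : Prop :=
  [/\ x = X t, t + dy k ^+ q <= 1, beta (X (t + dy k ^+ q)) <= al &
     (n (`]t, (t + dy k ^+ q)%R] `*` large e k) <= 0)%E] \/
  [/\ x = left_limit X t, 0 < t, 0 <= t - dy k ^+ q, beta x <= al &
     (n (`[(t - dy k ^+ q)%R, t[ `*` large e k) <= 0)%E].

Lemma eventually_dy_small (h : R) q : (0 < q)%N -> 0 < h ->
  exists K, forall k, (K <= k)%N -> dy k ^+ q <= h.
Proof.
case: q => // q _ h0; have [l hl] := dy_lt h0; exists l => k lk.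
apply: le_trans (ltW hl); apply: le_trans (dy_anti _ lk).
by rewrite exprS ger_pMr ?dy_gt0// exprn_ile1// dy_le1.
Qed.

Lemma eventually_right x t eta q : (0 < q)%N -> 0 <= t -> t < 1 -> x = X t -> 0 < eta ->
  exists K, forall k, (K <= k)%N ->
    t + dy k ^+ q <= 1 /\ beta (X (t + dy k ^+ q)) <= beta x + eta.
Proof.
move=> q0 t0 t1 -> eta0.
have [delta d0 hd] := beta_continuous (X t) eta0.
have c : X s @[s --> t^'+] --> X t by apply: X_cadlag.1; rewrite in_itv/= t0.
have [e /= e0 he] := (cvgrPdist_le _ _).1 c delta d0.
have m0 : 0 < Num.min (e / 2) (1 - t) by rewrite lt_min divr_gt0//= subr_gt0.
have [K hK] := eventually_dy_small q0 m0.
exists K => k /hK; rewrite le_min => /andP[h1 h2].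
have h0 : 0 < dy k ^+ q by rewrite exprn_gt0// dy_gt0.
split; first lra.
have hX : `|X t - X (t + dy k ^+ q)| <= delta.
  apply: he; last by rewrite ltrDl.
  by rewrite /= opprD addNKr normrN gtr0_norm//; lra.
have := hd (X (t + dy k ^+ q)); rewrite distrC => /(_ hX).
by rewrite ler_norml => /andP[_]; rewrite lerBlDl.
Qed.

Lemma eventually_left t q : (0 < q)%N -> 0 < t ->
  exists K, forall k, (K <= k)%N -> 0 <= t - dy k ^+ q.
Proof.
move=> q0 t0; have [K hK] := eventually_dy_small q0 t0.
by exists K => k /hK h; rewrite subr_ge0.
Qed.

Let jumps_at t e k : set (R * R) := [set t] `*` large e k.

(** A mark at [t] has a fixed size while the threshold tends to 0. *)
Lemma eventually_jump_seen t p : ~ (n ([set t] `*` `]0%R, 1%R]) <= 0)%E ->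
  exists K, forall k, (K <= k)%N -> (1 <= n (jumps_at t p.+1 k))%E.
Proof.
move=> nt.
have mJ k : measurable (jumps_at t p.+1 k).
  by apply: measurable_setX => //; exact: measurable_set1.
have [K hK] : exists K, (1 <= n (jumps_at t p.+1 K))%E.
  apply: contrapT => /forallNP h; apply: nt.
  have cov : [set t] `*` `]0, 1] `<=` \bigcup_k jumps_at t p.+1 k.
    move=> z [z1 /=]; rewrite in_itv/= => /andP[z2 z3].
    have [K hK] := eventually_dy_small (ltn0Sn p) z2.
    by exists K => //; split=> //; rewrite /large/= in_itv/= hK.
  apply: le_trans (measure_sigma_subadditive _ _ _ cov) _ => //.
    by apply: measurable_setX; [exact: measurable_set1|exact: measurable_itv].
  by rewrite eseries0// => k _ _; apply: le_anti; rewrite measure_ge0 andbT n_lt1.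
exists K => k Kk; apply: le_trans hK _; apply: le_measure; rewrite ?inE//.
move=> z [z1]; rewrite /large/= in_itv/= => /andP[z2 z3]; split=> //=.
rewrite /large/= in_itv/= z3 andbT; apply: le_trans z2.
by rewrite lerXn2r ?nnegrE// dy_anti.
Qed.

(** Around an interior [t] there is at most one large jump. If [t] has a jump, it is eventually that
    one, and both sides are free. Otherwise [x] is both [X t] and the left limit, so either side
    serves and one of them is free. The end times are covered by [n_ends]. *)
Lemma eventually_side x t p eta : 0 <= t <= 1 -> 0 < eta ->
  (t < 1 /\ x = X t) \/ (0 < t /\ x = left_limit X t) ->
  exists K, forall k, (K <= k)%N -> side x t (beta x + eta) p.+2.*2 p.+1 k.
Proof.
move=> /andP[t0 t1] eta0 loc; set q := p.+2.*2.
have q0 : (0 < q)%N by [].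
have pq : (p.+1 < q)%N by rewrite /q -addnn ltn_addr.
have [Ke he] := n_ends pq.
have [Kw hw] := n_windows p.+1; rewrite -/q in hw.
have h0 k : 0 < dy k ^+ q by rewrite exprn_gt0// dy_gt0.
have mR k : measurable (`]t, (t + dy k ^+ q)%R] `*` large p.+1 k : set (R * R)).
  by apply: measurable_setX => //; exact: measurable_itv.
have mL k : measurable (`[(t - dy k ^+ q)%R, t[ `*` large p.+1 k : set (R * R)).
  by apply: measurable_setX => //; exact: measurable_itv.
have mJ k : measurable (jumps_at t p.+1 k).
  by apply: measurable_setX => //; exact: measurable_set1.
have [tz|tn0] := eqVneq t 0.
  have tl1 : t < 1 by rewrite tz.
  have xE : x = X t by case: loc => [[]//|[]]; rewrite tz ltxx.
  have [Kr hr] := eventually_right q0 t0 tl1 xE eta0.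
  exists (maxn Kr Ke) => k; rewrite geq_max => /andP[k1 k2]; left.
  have [h1 h2] := hr k k1; split => //; have [h3 _] := he k k2.
  apply: le_trans h3; apply: le_measure; rewrite ?inE//.
    by apply: measurable_setX => //; exact: measurable_itv.
  move=> z [/= + z2]; rewrite tz in_itv/= add0r => /andP[/ltW z1 z3].
  by split=> //=; rewrite in_itv/= z1.
have tp : 0 < t by rewrite lt_neqAle eq_sym tn0.
have [Kl hl] := eventually_left q0 tp.
have bx : beta x <= beta x + eta by rewrite lerDl ltW.
have [tz|tn1] := eqVneq t 1.
  have xE : x = left_limit X t by case: loc => [[]|[]//]; rewrite tz ltxx.
  exists (maxn Kl Ke) => k; rewrite geq_max => /andP[k1 k2]; right.
  split => //; first exact: hl; have [_ h3] := he k k2.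
  apply: le_trans h3; apply: le_measure; rewrite ?inE//.
    by apply: measurable_setX => //; exact: measurable_itv.
  move=> z [/= + z2]; rewrite tz in_itv/= => /andP[z1 /ltW z3].
  by split=> //=; rewrite in_itv/= z1.
have tl1 : t < 1 by rewrite lt_neqAle tn1.
have around k A B : (Kw <= k)%N -> measurable A -> measurable B -> A `&` B = set0 ->
    A `|` B `<=` `[t - dy k ^+ q, t + dy k ^+ q] `*` large p.+1 k ->
    (1 <= n A)%E -> (n B <= 0)%E.
  move=> Kk mA mB AB ABs; have [i [i1 i2 ic]] := locate_cell q k t0.
  rewrite -[i.+1%:R]natr1 in i2.
  apply: (n_disjoint mA mB _ AB _ (hw k Kk i (ic t1))).
    by apply: measurable_setX.
  move=> z /ABs[/= + z2]; rewrite in_itv/= => /andP[z1 z3]; split=> //=.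
  rewrite /window/= in_itv/=; have := h0 k => hk; apply/andP; split; nra.
have JR k : jumps_at t p.+1 k `&` (`]t, (t + dy k ^+ q)%R] `*` large p.+1 k) = set0.
  rewrite -subset0 => z [[/= zt _] [/= + _]].
  by rewrite zt in_itv/= ltxx.
have JL k : jumps_at t p.+1 k `&` (`[(t - dy k ^+ q)%R, t[ `*` large p.+1 k) = set0.
  rewrite -subset0 => z [[/= zt _] [/= + _]].
  by rewrite zt in_itv/= ltxx andbF.
have RL k : (`]t, (t + dy k ^+ q)%R] `*` large p.+1 k) `&`
    (`[(t - dy k ^+ q)%R, t[ `*` large p.+1 k) = set0 :> set (R * R).
  rewrite -subset0 => z [[/= + _] [/= + _]]; rewrite !in_itv/= => /andP[a _] /andP[_ b].
  by have := lt_trans a b; rewrite ltxx.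
have subJ k : jumps_at t p.+1 k `<=` `[t - dy k ^+ q, t + dy k ^+ q] `*` large p.+1 k.
  move=> z [/= zt z2]; split=> //=; rewrite zt in_itv/=; have := h0 k => hk.
  by apply/andP; split; lra.
have subR k : `]t, (t + dy k ^+ q)%R] `*` large p.+1 k `<=`
    `[t - dy k ^+ q, t + dy k ^+ q] `*` (large p.+1 k : set R).
  move=> z [/= + z2]; rewrite !in_itv/= => /andP[a b]; split=> //=; have := h0 k => hk.
  by rewrite ?in_itv/= b andbT; lra.
have subL k : `[(t - dy k ^+ q)%R, t[ `*` large p.+1 k `<=`
    `[t - dy k ^+ q, t + dy k ^+ q] `*` (large p.+1 k : set R).
  move=> z [/= + z2]; rewrite !in_itv/= => /andP[a b]; split=> //=; have := h0 k => hk.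
  by rewrite ?in_itv/= a/=; lra.
have [nt|nt] := pselect (n ([set t] `*` `]0%R, 1%R]) <= 0)%E.
  have LX := left_limit_no_jump tp t1 nt.
  have xE : x = X t by case: loc => -[_ ->].
  have [Kr hr] := eventually_right q0 t0 tl1 xE eta0.
  exists (maxn Kw (maxn Kl Kr)) => k; rewrite !geq_max => /and3P[k1 k2 k3].
  have [h1 h2] := hr k k3.
  have [nR|nR] := pselect (1 <= n (`]t, (t + dy k ^+ q)%R] `*` large p.+1 k))%E.
    right; split=> //; [by rewrite LX|exact: hl|].
    by apply: (around k _ _ k1 (mR k) (mL k) (RL k) _ nR); rewrite subUset.
  by left; split=> //; exact: n_lt1.
have [Kj hj] := eventually_jump_seen p nt.
case: loc => -[tt xE].
  have [Kr hr] := eventually_right q0 t0 tt xE eta0.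
  exists (maxn Kw (maxn Kj Kr)) => k; rewrite !geq_max => /and3P[k1 k2 k3].
  have [h1 h2] := hr k k3; left; split=> //.
  by apply: (around k _ _ k1 (mJ k) (mR k) (JR k) _ (hj k k2)); rewrite subUset.
exists (maxn Kw (maxn Kj Kl)) => k; rewrite !geq_max => /and3P[k1 k2 k3].
right; split=> //; first exact: hl.
by apply: (around k _ _ k1 (mJ k) (mL k) (JL k) _ (hj k k2)); rewrite subUset.
Qed.

(** At infinitely many scales both sides are free, so the side is dictated by [x] alone. *)
Lemma frequently_side x t e eta : 0 <= t <= 1 -> 0 < eta ->
  (t < 1 /\ x = X t) \/ (0 < t /\ x = left_limit X t) ->
  forall k0, exists2 k, (k0 <= k)%N & side x t (beta x + eta) e.+1 e k.
Proof.
move=> t01 eta0 loc k0; have /andP[t0 t1] := t01.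
have mP k : measurable (punctured t (dy k ^+ e.+1) `*` large e k : set (R * R)).
  by apply: measurable_setX => //; exact: measurable_punctured.
have h0 k : 0 < dy k ^+ e.+1 by rewrite exprn_gt0// dy_gt0.
case: loc => -[tt xE].
  have [Kr hr] := eventually_right (ltn0Sn e) t0 tt xE eta0.
  have [k] := n_punctured e t01 (maxn k0 Kr); rewrite geq_max => /andP[k1 k2] nP.
  exists k => //; have [h1 h2] := hr k k2; left; split=> //.
  apply: le_trans nP; apply: le_measure; rewrite ?inE//.
    by apply: measurable_setX => //; exact: measurable_itv.
  move=> z [/= + z2]; rewrite in_itv/= => /andP[a b]; split=> //; split=> /=.
    by rewrite ?in_itv/= b andbT; have := h0 k; lra.
  by move=> zt; move: a; rewrite zt ltxx.
have [Kl hl] := eventually_left (ltn0Sn e) tt.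
have [k] := n_punctured e t01 (maxn k0 Kl); rewrite geq_max => /andP[k1 k2] nP.
exists k => //; right; split=> //; [exact: hl|by rewrite lerDl ltW|].
apply: le_trans nP; apply: le_measure; rewrite ?inE//.
  by apply: measurable_setX => //; exact: measurable_itv.
move=> z [/= + z2]; rewrite in_itv/= => /andP[a b]; split=> //; split=> /=.
  by rewrite ?in_itv/= a/=; have := h0 k; lra.
by move=> zt; move: b; rewrite zt ltxx.
Qed.

Lemma dy_expR q k : dy k ^+ q = expR (- (k%:R * (q%:R * ln 2))).
Proof.
have d0 := dy_gt0 R k.
rewrite -[LHS]lnK ?posrE ?exprn_gt0// lnXn// lnXn ?invr_gt0// lnV ?posrE//.
by congr expR; rewrite -[_ *+ q]mulr_natl -[_ *+ k]mulr_natl; ring.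
Qed.

Lemma dy_powR_expR e k al : (dy k ^+ e) `^ al^-1 = expR (- (k%:R * (e%:R * ln 2 / al))).
Proof. by rewrite dy_expR -expRM; congr expR; ring. Qed.

Let ln2_gt0 : 0 < ln 2 :> R. Proof. by rewrite ln_gt0// ltr1n. Qed.

(** * Local dimensions at a point of the support *)

Section AtSupport.
Variable x : R.
Hypothesis x_support : msupport mu x.

Let mu_gt0 r : 0 < r -> (0 < mu (ball x r))%E. Proof. exact: x_support. Qed.
Let mu_fin r := occupation_measure_ball_fin x r.

Let inv_lt (eps : R) : 0 < eps -> exists2 e, (0 < e)%N & e%:R^-1 <= eps.
Proof.
move=> e0; exists (Num.truncn eps^-1).+1 => //.
by rewrite -[leRHS]invrK lef_pV2 ?posrE ?invr_gt0// ltW// truncnS_gt.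
Qed.

(** With [al = beta x - eta] the exponent is [A / B = al * q / (q + 1)]; the three errors are at
    most [eps / 3] each. *)
Lemma lower_local_dim_ge_beta : ((beta x)%:E <= lower_local_dim mu x)%E.
Proof.
apply/lee_subgt0Pr => eps eps0'.
have bx := beta_gt0 x.
have bx1 : beta x < 1 by have /andP[_ h] := beta_range x; have := eps0_gt0; lra.
pose eta := Num.min (eps / 3) (beta x / 2).
have eta0 : 0 < eta by rewrite lt_min !divr_gt0.
have eta1 : eta <= eps / 3 by rewrite /eta ge_min lexx.
have eta2 : eta <= beta x / 2 by rewrite /eta ge_min lexx orbT.
have [delta d0 hd] := beta_continuous x eta0.
pose al := beta x - eta; have al0 : 0 < al by rewrite /al; lra.
have bal : al <= beta (x - delta).
  have : `|x - delta - x| <= delta by rewrite addrAC subrr add0r normrN gtr0_norm.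
  by move=> /hd; rewrite ler_norml => /andP[h _]; rewrite /al; lra.
have [q q0 hq] : exists2 q, (0 < q)%N & q%:R^-1 <= eps / 3 by apply: inv_lt; rewrite divr_gt0.
have [K hK] := n_cells q.
pose A : R := q%:R * ln 2; pose B : R := q.+1%:R * ln 2 / al.
have A0 : 0 < A by rewrite mulr_gt0// ltr0n.
have B0 : 0 < B by rewrite divr_gt0// mulr_gt0.
have scales k r : (maxn K 1 <= k)%N -> 0 < r -> r <= delta -> 2 * r <= expR (- (k%:R * B)) ->
     (mu (ball x r) <= (4 * expR (- (k%:R * A)))%:E)%E.
  rewrite geq_max => /andP[Kk k0] r0 rd; rewrite /A /B -dy_powR_expR -dy_expR.
  by apply: (occupation_measure_ball_le al0 rd bal k0); exact: hK.
have := lower_local_dim_ge_scales mu_gt0 mu_fin A0 B0 d0 eta0 scales.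
apply: le_trans; rewrite -EFinB lee_fin.
have AB : A / B = al - al / q.+1%:R.
  rewrite /A /B -[q.+1%:R]natr1; field.
  by rewrite !gt_eqF//= natr1 ltr0n.
have : al / q.+1%:R <= q%:R^-1.
  apply: (@le_trans _ _ (1 / q.+1%:R)); first by rewrite ler_wpM2r ?invr_ge0// /al; lra.
  by rewrite div1r lef_pV2 ?posrE ?ltr0n// ler_nat.
rewrite AB; set y := al / _; rewrite /al; lra.
Qed.

Lemma scales_side t al q e k (m := (q + 24)%N) : 0 <= t -> t <= 1 -> al < 1 -> side x t al q e k ->
  (forall i j, (i <= cells q k)%N ->
    (n (window q k i `*` block e k j) <= ((q + 24) * 2 ^ j)%N%:R%:E)%E) ->
  forall r, Num.max 1 (increment_cst m al) * expR (- (k%:R * (e%:R * ln 2 / al))) < r ->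
  ((expR (- (k%:R * (q%:R * ln 2))))%:E <= mu (ball x r))%E.
Proof.
move=> t0 t1 al1 sd hblocks r hr; rewrite -dy_expR.
apply: (occupation_measure_ball_ge t0 t1 al1 hblocks sd); apply: le_lt_trans hr.
by rewrite dy_powR_expR ler_wpM2r ?expR_ge0// le_max lexx orbT.
Qed.

(** An index below 1 is what makes the series of small jumps converge; [eps0 / 2] leaves room for
    it. *)
Lemma small_margin (eps : R) : 0 < eps -> exists eta,
  [/\ 0 < eta, eta <= eps, eta <= 1 & beta x + eta < 1].
Proof.
move=> eps0'; exists (Num.min (Num.min eps 1) (eps0 / 2)).
have h : Num.min (Num.min eps 1) (eps0 / 2) <= eps0 / 2 by rewrite ge_min lexx orbT.
split.
- by rewrite !lt_min eps0' ltr01 divr_gt0.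
- by rewrite !ge_min lexx.
- by rewrite !ge_min lexx orbT.
- have /andP[_ h'] := beta_range x; have := eps0_gt0; lra.
Qed.

(** Here [A / B = al * (e + 1) / e] with [al = beta x + eta], along the scales of
    [frequently_side]. *)
Lemma lower_local_dim_le_beta : (lower_local_dim mu x <= (beta x)%:E)%E.
Proof.
apply/lee_addgt0Pr => eps eps0'.
have bx := beta_gt0 x.
have e30 : 0 < eps / 3 by rewrite divr_gt0.
have [eta [eta0 eta1 _ al1]] := small_margin e30.
pose al := beta x + eta; rewrite -/al in al1; have al0 : 0 < al by rewrite /al; lra.
have [t t01 loc] := msupport_location x_support; have /andP[t0 t1] := t01.
have [e e0 he] := inv_lt e30.
have [K hK] := n_blocks (ltnSn e).
pose A : R := e.+1%:R * ln 2; pose B : R := e%:R * ln 2 / al.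
have A0 : 0 < A by rewrite mulr_gt0.
have B0 : 0 < B by rewrite divr_gt0// mulr_gt0// ltr0n.
pose C := Num.max 1 (increment_cst (e.+1 + 24) al).
have C0 : 0 < C by rewrite lt_max ltr01.
have scales k0 : exists2 k, (k0 <= k)%N & forall r, C * expR (- (k%:R * B)) < r ->
     ((expR (- (k%:R * A)))%:E <= mu (ball x r))%E.
  have [k] := frequently_side e t01 eta0 loc (maxn k0 K); rewrite geq_max => /andP[k1 k2] sd.
  by exists k => //; apply: (scales_side t0 t1 al1 sd); exact: hK.
apply: le_trans (lower_local_dim_le_scales mu_fin A0 B0 C0 e30 scales) _.
rewrite -EFinD lee_fin.
have -> : A / B = al + al * e%:R^-1.
  by rewrite /A /B -[e.+1%:R]natr1; field; rewrite !gt_eqF// ltr0n.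
have : al * e%:R^-1 <= e%:R^-1 by rewrite ger_pMl ?invr_gt0 ?ltr0n// ltW.
move=> /le_trans /(_ he); set y := al * _; rewrite /al; lra.
Qed.

(** All small scales are now covered, with threshold exponent [p + 1] against cell exponent
    [2 * (p + 2)]; hence [A / B = 2 * al * (p + 2) / (p + 1)]. *)
Lemma upper_local_dim_le_2beta : (upper_local_dim mu x <= (2 * beta x)%:E)%E.
Proof.
apply/lee_addgt0Pr => eps eps0'.
have bx := beta_gt0 x.
have e80 : 0 < eps / 8 by rewrite divr_gt0.
have [eta [eta0 eta1 _ al1]] := small_margin e80.
pose al := beta x + eta; rewrite -/al in al1; have al0 : 0 < al by rewrite /al; lra.
have [t t01 loc] := msupport_location x_support; have /andP[t0 t1] := t01.
have [[//|p] p0 hp] := inv_lt e80.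
pose q := p.+2.*2.
have pq : (p.+1 < q)%N by rewrite /q -addnn ltn_addr.
have [K hK] := n_blocks pq.
have [K' hK'] := eventually_side p t01 eta0 loc.
pose A : R := q%:R * ln 2; pose B : R := p.+1%:R * ln 2 / al.
have A0 : 0 < A by rewrite mulr_gt0.
have B0 : 0 < B by rewrite divr_gt0// mulr_gt0.
pose C := Num.max 1 (increment_cst (q + 24) al).
have C0 : 0 < C by rewrite lt_max ltr01.
have scales k r : (maxn K K' <= k)%N -> C * expR (- (k%:R * B)) < r ->
     ((expR (- (k%:R * A)))%:E <= mu (ball x r))%E.
  rewrite geq_max => /andP[k1 k2].
  by apply: (scales_side t0 t1 al1 (hK' k k2)); exact: hK.
apply: le_trans (upper_local_dim_le_scales mu_fin A0 B0 C0 e80 scales) _.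
rewrite -EFinD lee_fin.
have -> : A / B = 2 * al + 2 * (al * p.+1%:R^-1).
  have -> : A = (2 * (p.+1%:R + 1)) * ln 2.
    by rewrite /A /q -muln2 natrM -[p.+2%:R]natr1; set y := p.+1%:R; ring.
  by rewrite /B; set y := p.+1%:R; field; rewrite !gt_eqF// ltr0n.
have : al * p.+1%:R^-1 <= p.+1%:R^-1 by rewrite ger_pMl ?invr_gt0 ?ltr0n// ltW.
move=> /le_trans /(_ hp); set y := al * _; rewrite /al; lra.
Qed.

End AtSupport.

Lemma path_local_dimensions x : msupport mu x ->
  lower_local_dim mu x = (beta x)%:E /\
  ((beta x)%:E <= upper_local_dim mu x <= (2 * beta x)%:E)%E.
Proof.
move=> sx; have lo : lower_local_dim mu x = (beta x)%:E.
  by apply: le_anti; rewrite lower_local_dim_le_beta// lower_local_dim_ge_beta.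
split=> //; rewrite upper_local_dim_le_2beta// andbT -lo.
exact: lower_le_upper_local_dim.
Qed.

End Paths.

Theorem theorem1 (R : realType) (d : measure_display) (Omega : measurableType d)
    (P : probability Omega R) (N : R.-ker Omega ~> (R * R)%type)
    (eps0 : R) (beta : R -> R) (M : R -> Omega -> R)
    (eps0_gt0 : 0 < eps0)
    (beta_range : forall x, eps0 <= beta x <= 1 - eps0)
    (beta_nowhere_constant : nowhere_constant beta)
    (beta_nondecreasing : {homo beta : x y / x <= y})
    (beta_lipschitz : exists k : R, k.-lipschitz beta)
    (N_poisson : poisson_random_measure P (@jump_intensity R) N)
    (M_stable_like : stable_like_process P N beta M) :
  {ae P, forall w : Omega, forall x : R,
    msupport (occupation_measure (M^~ w)) x ->
    lower_local_dim (occupation_measure (M^~ w)) x = (beta x)%:E /\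
    ((beta x)%:E <= upper_local_dim (occupation_measure (M^~ w)) x
       <= (2 * beta x)%:E)%E}.
Proof.
have [_ M_cadlag M_eq] := M_stable_like.
have N_integer := let: And3 h _ _ := N_poisson in h.
have cells_ae := ae_foralln (fun q => ae_jump_in_every_cell N_poisson q).
(* Countably many exponents give a common null set. Writing the cell exponent as [q + e.+1] builds
   in the condition that it exceeds [e]; it is undone below by the choice [q - e.+1]. *)
have blocks_ae := ae_foralln (fun q => ae_foralln (fun e =>
  ae_small_jump_counts N_poisson (leq_addl q e.+1))).
have windows_ae := ae_foralln (fun p => ae_at_most_one_large_jump N_poisson p).
have ends_ae := ae_foralln (fun q => ae_foralln (fun e =>
  ae_no_large_jump_near_ends N_poisson (leq_addl q e.+1))).
have punctured_ae := ae_foralln (fun e => ae_no_persistently_bad_time N_poisson e).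
apply: filterS (filterI M_cadlag (filterI M_eq (filterI cells_ae (filterI blocks_ae
  (filterI windows_ae (filterI ends_ae punctured_ae)))))).
move=> w [wc [we [wcells [wblocks [wwindows [wends wpunctured]]]]]] x.
apply: (path_local_dimensions eps0_gt0 beta_range beta_nondecreasing wc we
  beta_lipschitz (N_integer w) wcells _ wwindows _ wpunctured).
  by move=> q e eq; have := wblocks (q - e.+1)%N e; rewrite subnK.
by move=> q e eq; have := wends (q - e.+1)%N e; rewrite subnK.
Qed.
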